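(* The first (smallest) eigenvalue $\lambda_{1,S}(\mathcal{A})$ of the Stokes operator $\boldsymbol{S}$ on the three-dimensional annulus $\Omega_{\mathcal{A}}$ with vanishing Dirichlet traces satisfies $$\lim_{\mathcal{A}\to\infty}\lambda_{1,S}(\mathcal{A})=\pi^2 .$$
   Context: For $\mathcal{A}\in(0,\infty)$ let $\Omega_{\mathcal{A}}:=\{\underline{x}\in\mathbb{R}^3:\ \mathcal{A}/2<\|\underline{x}\|<1+\mathcal{A}/2\}$, where $\|\cdot\|$ is the Euclidean norm. For $\Omega=\Omega_{\mathcal{A}}$ let $\underline{\mathcal{V}}(\Omega)$ be the set of all divergence-free (solenoidal) vector fields in $C_0^\infty(\Omega)^3$, let $\underline{\mathbb{H}}(\Omega)$ be its closure in $L_2(\Omega)^3$ and $\underline{\mathbb{V}}(\Omega)$ its closure in $W_2^1(\Omega)^3$, where $W_2^k(\Omega)$ is the usual Sobolev space of order $k$ based on $L_2$. Let $\Upsilon:L_2(\Omega)^3\to\underline{\mathbb{H}}(\Omega)$ be the Leray–Helmholtz (orthogonal) projection. The Stokes operator $\boldsymbol{S}$ is the Friedrichs extension in $\underline{\mathbb{H}}(\Omega)$ of the operator $\underline{v}\mapsto-\Delta\underline{v}$ defined on $\underline{\mathcal{V}}(\Omega)$; it has domain $W_2^2(\Omega)^3\cap\underline{\mathbb{V}}(\Omega)$ and is given there by $\boldsymbol{S}=-\Upsilon\Delta$. It is a positive self-adjoint operator with compact inverse and hence with pure point spectrum; $\lambda_{1,S}(\mathcal{A})$ denotes its smallest eigenvalue.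 *)

(* Defs.v *)
From HB Require Import structures.
From mathcomp Require Import all_boot all_order all_algebra.
From mathcomp Require Import all_classical all_reals all_analysis.

Set Implicit Arguments.
Unset Strict Implicit.
Unset Printing Implicit Defensive.

Import Order.TTheory GRing.Theory Num.Theory.
Import numFieldNormedType.Exports.
Local Open Scope classical_set_scope.
Local Open Scope ring_scope.

(** Elements of a Hilbert space of functions are represented by functions, two
  of them denoting the same element when the semi-inner product [ip] of their
  difference with itself vanishes. *)

Definition ip_dist2 (R : realType) (E : lmodType R) (ip : E -> E -> R)
  (u v : E) : R := ip (u - v) (u - v).

Definition ip_closure (R : realType) (E : lmodType R) (ip : E -> E -> R)
    (L D : set E) : set E :=
  [set u | L u /\ forall e : R, 0 < e -> exists2 v, D v & ip_dist2 ip v u < e].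

(** Domain of the closure of the quadratic form [v |-> ip (T v) v], initially
  defined on [D], for a nonnegative symmetric operator [T] on [D]. *)
Definition closed_form_domain (R : realType) (E : lmodType R)
    (ip : E -> E -> R) (H D : set E) (T : E -> E) : set E :=
  [set u | H u /\ exists v : nat -> E,
    [/\ forall n, D (v n),
        ip_dist2 ip (v n) u @[n --> \oo] --> (0 : R)
      & forall e : R, 0 < e -> exists N : nat, forall m n : nat,
          (N <= m)%N -> (N <= n)%N ->
          ip (T (v m - v n)) (v m - v n) < e]].

(** Graph of the Friedrichs extension in [H] of [T], initially defined on [D]:
  the restriction of the adjoint of [T] to the domain of the closed form. *)
Definition friedrichs (R : realType) (E : lmodType R)
    (ip : E -> E -> R) (H D : set E) (T : E -> E) (u f : E) : Prop :=
  [/\ closed_form_domain ip H D T u,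
      H f
    & forall w, D w -> ip u (T w) = ip f w].

(** Eigenvalues of an operator given by its graph; the condition on [ip u u]
  says that [u] is nonzero as an element of the Hilbert space. *)
Definition eigenvalues (R : realType) (E : lmodType R) (ip : E -> E -> R)
    (G : E -> E -> Prop) : set R :=
  [set l | exists2 u, ip u u != 0 & G u (l *: u)].

(** The library norm on a product is the sup norm, hence the separate
  [enorm3]; the topology is the usual one. *)
Notation R3 R := (R * R * R)%type.

Definition crd (R : realType) (i : 'I_3) (x : R3 R) : R :=
  match val i with 0%N => x.1.1 | 1%N => x.1.2 | _ => x.2 end.

Definition basis3 (R : realType) (i : 'I_3) : R3 R :=
  ((i == 0%N :> nat)%:R, (i == 1%N :> nat)%:R, (i == 2%N :> nat)%:R).

Definition enorm3 (R : realType) (x : R3 R) : R :=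
  Num.sqrt (\sum_(i < 3) crd i x ^+ 2).

Definition partial (R : realType) (i : 'I_3) (f : R3 R -> R) : R3 R -> R :=
  fun x => 'D_(basis3 R i) f x.

Fixpoint Ck (R : realType) (k : nat) (f : R3 R -> R) : Prop :=
  match k with
  | 0%N => continuous f
  | k'.+1 => [/\ continuous f,
                 forall i x, derivable f x (basis3 R i)
               & forall i, Ck k' (partial i f)]
  end.

Definition Cinfty_c (R : realType) (Om : set (R3 R)) : set (R3 R -> R) :=
  [set f | (forall k, Ck k f) /\
    exists K : set (R3 R),
      [/\ compact K, K `<=` Om & forall x, ~ K x -> f x = 0]].

Notation field3 R := ('I_3 -> R3 R -> R).

Definition div3 (R : realType) (u : field3 R) (x : R3 R) : R :=
  \sum_(i < 3) partial i (u i) x.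

Definition laplacian3 (R : realType) (u : field3 R) : field3 R :=
  fun j x => \sum_(i < 3) partial i (partial i (u j)) x.

Definition solenoidal_c (R : realType) (Om : set (R3 R)) : set (field3 R) :=
  [set v | (forall i, Cinfty_c Om (v i)) /\ forall x, div3 v x = 0].

(** [measurableTypeR R] is [R] with its Borel sets, in the form expected by
  [lebesgue_measure]; [mR3 R] is [R3 R] with the product structure. *)
Notation mR3 R :=
  (measurableTypeR R * measurableTypeR R * measurableTypeR R)%type.

Definition leb3 (R : realType) : {measure set (mR3 R) -> \bar R} :=
  ((@lebesgue_measure R \x @lebesgue_measure R) \x @lebesgue_measure R)%E.
Arguments leb3 R : clear implicits.

Definition L2_3 (R : realType) (Om : set (R3 R)) : set (field3 R) :=
  [set u | forall i,
    measurable_fun (Om : set (mR3 R)) (u i : mR3 R -> R) /\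
    (leb3 R).-integrable Om (fun x => (u i x ^+ 2)%:E)].

Definition L2_ip (R : realType) (Om : set (R3 R)) (u v : field3 R) : R :=
  Rintegral (leb3 R) Om (fun x => \sum_(i < 3) u i x * v i x).

Definition L2_sigma (R : realType) (Om : set (R3 R)) : set (field3 R) :=
  ip_closure (L2_ip Om) (L2_3 Om) (solenoidal_c Om).

Definition stokes (R : realType) (Om : set (R3 R)) :
    field3 R -> field3 R -> Prop :=
  friedrichs (L2_ip Om) (L2_sigma Om) (solenoidal_c Om)
    (fun v => - laplacian3 v).

Definition annulus (R : realType) (A : R) : set (R3 R) :=
  [set x | A / 2 < enorm3 x < 1 + A / 2].

(** The operator is positive with compact inverse, so the infimum below is
  mathematically a minimum. [inf] of the empty set would be 0 by convention. *)
Definition stokes_eigenvalue1 (R : realType) (A : R) : R :=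
  inf (eigenvalues (L2_ip (annulus A)) (stokes (annulus A))).

Lemma stokes_eigenvalue1_min (R : realType) (A l : R) :
  eigenvalues (L2_ip (annulus A)) (stokes (annulus A)) l ->
  lbound (eigenvalues (L2_ip (annulus A)) (stokes (annulus A))) l ->
  stokes_eigenvalue1 A = l.
Proof.
move=> El lbl; apply/eqP; rewrite eq_le; apply/andP; split.
  by apply: ge_inf => //; exists l.
by apply: lb_le_inf => //; exists l.
Qed.

(* Main.v *)
From HB Require Import structures.
Require Import Defs.
From mathcomp Require Import all_boot all_order all_algebra.
From mathcomp Require Import all_classical all_reals all_analysis.
From mathcomp Require Import measurable_realfun ring lra.

Import Order.TTheory GRing.Theory Num.Theory.
Import numFieldNormedType.Exports.
Local Open Scope classical_set_scope.
Local Open Scope ring_scope.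

(** Both bounds come from explicit functions; compactness of the resolvent is
  never invoked.

  Lower bound. Every eigenvalue is at least [pi ^+ 2], whatever [A] is. In
  dimension three the function [f = sin (pi (r - A / 2)) / r] satisfies
  [- lap f = pi ^+ 2 f], and on a shell of width one it is positive inside and
  vanishes on both boundary spheres. Writing a test function as [v = z f], the
  energy of [v] is [pi ^+ 2] times its squared norm plus the integral of
  [|grad z| ^+ 2 f ^+ 2] ([ground_state]), hence [energy_ge]. The bound passes
  from test fields, component by component, to the eigenvalues of the Friedrichs
  extension ([friedrichs_eigenvalue_ge]).

  Upper bound. If [psi = sin (k r + th) / r], the cross product of [grad psi]
  with a fixed vector is a solenoidal field whose components satisfy the
  Helmholtz equation with eigenvalue [k ^+ 2]; it vanishes on the sphere of
  radius [r] exactly when [psi] has a critical point there, that is when the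
  tangent of the phase [k r + th] equals [k r]. Both radii satisfy this if
  [k = pi + atan (k (1 + A / 2)) - atan (k A / 2)], which has a solution
  ([wave_number_exists]), and then [k <= 3 pi / 2 - atan (pi A / 2)], a bound
  that tends to [pi]. So [k ^+ 2] is an eigenvalue squeezed between [pi ^+ 2]
  and a quantity with the same limit.

  It remains to see that this field [u] lies in the domain of the Friedrichs
  extension. It is approximated by [cutoff n * u], where the cutoffs depend on
  [r] only, so that the products remain solenoidal. By [ground_state] again, now
  with the components of [u] as solutions and differences of cutoffs as factors,
  the energies of the differences are controlled by the squared norms of
  [(cutoff n - 1) * u] and the integrals of [|grad (cutoff n)| ^+ 2 |u| ^+ 2].
  Both tend to zero by dominated convergence, the latter because [u] vanishes to
  first order at the boundary.

  All integrations by parts reduce to [integral_partial_eq0]: a partial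
  derivative of a compactly supported function has integral zero. *)

Set Implicit Arguments.
Unset Strict Implicit.
Unset Printing Implicit Defensive.

(** * Functions of class C^k on an open set *)

Section Calculus.
Context {R : realType}.
Local Notation X := (R3 R).
Implicit Types (f g : X -> R) (U : set X) (i : 'I_3) (x : X).

(** A local form of [Ck]: the radial profiles used below are singular at the
  origin, and compactly supported functions are glued from two open pieces. *)
Fixpoint Ck_on (U : set X) (k : nat) (f : X -> R) : Prop :=
  match k with
  | 0%N => forall x, U x -> {for x, continuous f}
  | k'.+1 => [/\ forall x, U x -> {for x, continuous f},
                 forall i x, U x -> derivable f x (basis3 R i)
               & forall i, Ck_on U k' (partial i f)]
  end.

Lemma Ck_onT k f : Ck_on setT k f <-> Ck k f.
Proof.
elim: k f => [|k IH] f /=; first by split=> [h x|h x _]; exact: h.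
split=> -[h1 h2 h3]; split.
- by move=> x; exact: h1.
- by move=> i x; exact: h2.
- by move=> i; apply/IH.
- by move=> x _; exact: h1.
- by move=> i x _; exact: h2.
- by move=> i; apply/IH.
Qed.

Lemma Ck_on_continuous U k f x : Ck_on U k f -> U x -> {for x, continuous f}.
Proof. by case: k => [h|k [h _ _]]; exact: h. Qed.

Lemma Ck_on_derivable U k f i x :
  Ck_on U k.+1 f -> U x -> derivable f x (basis3 R i).
Proof. by move=> [_ h _]; exact: h. Qed.

Lemma Ck_on_partial U k f i : Ck_on U k.+1 f -> Ck_on U k (partial i f).
Proof. by move=> [_ _ h]; exact: h. Qed.

Lemma Ck_onS U k f : Ck_on U k.+1 f -> Ck_on U k f.
Proof.
elim: k f => [|k IH] f; first by move=> [].
by move=> [h1 h2 h3]; split=> // i; exact/IH/h3.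
Qed.

Lemma Ck_on_le U k l f : (l <= k)%N -> Ck_on U k f -> Ck_on U l f.
Proof.
move=> /subnKC <-; elim: (k - l)%N => [|n IH]; first by rewrite addn0.
by rewrite addnS => /Ck_onS.
Qed.

Lemma Ck_on_sub U V k f : U `<=` V -> Ck_on V k f -> Ck_on U k f.
Proof.
move=> UV; elim: k f => [|k IH] f; first by move=> h x /UV; exact: h.
move=> [h1 h2 h3]; split.
- by move=> x /UV; exact: h1.
- by move=> i x /UV; exact: h2.
- by move=> i; exact/IH/h3.
Qed.

Lemma Ck_onU U V k f : Ck_on U k f -> Ck_on V k f -> Ck_on (U `|` V) k f.
Proof.
elim: k f => [|k IH] f; first by move=> h1 h2 x [Ux|Vx]; [exact: h1|exact: h2].
move=> [h1 h2 h3] [k1 k2 k3]; split.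
- by move=> x [Ux|Vx]; [exact: h1|exact: k1].
- by move=> i x [Ux|Vx]; [exact: h2|exact: k2].
- by move=> i; exact: IH (h3 i) (k3 i).
Qed.

Lemma near_open_eq U f g x : open U -> (forall y, U y -> f y = g y) -> U x ->
  \forall y \near x, f y = g y.
Proof.
move=> oU fg Ux; have := open_nbhs_nbhs (conj oU Ux).
by apply: filterS => y; exact: fg.
Qed.

Lemma eq_partial U f g i x : open U -> (forall y, U y -> f y = g y) -> U x ->
  partial i f x = partial i g x.
Proof. by move=> oU fg Ux; apply: near_eq_derive; exact: near_open_eq Ux. Qed.

Lemma near_eq_continuous f g x : (\forall y \near x, f y = g y) ->
  {for x, continuous f} -> {for x, continuous g}.
Proof.
move=> fg hf; have fgx : f x = g x := nbhs_singleton fg.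
suff : g @ x --> f x by rewrite fgx.
apply: cvg_trans hf; apply: near_eq_cvg.
by apply: filterS fg => y /esym.
Qed.

Lemma eq_Ck_on U k f g : open U -> (forall x, U x -> f x = g x) ->
  Ck_on U k f -> Ck_on U k g.
Proof.
move=> oU; elim: k f g => [|k IH] f g fg.
  move=> h x Ux; apply: near_eq_continuous (h _ Ux).
  exact: near_open_eq Ux.
move=> [h1 h2 h3]; split.
- move=> x Ux; apply: near_eq_continuous (h1 _ Ux).
  exact: near_open_eq Ux.
- move=> i x Ux; apply: near_eq_derivable (h2 i x Ux).
  exact: near_open_eq Ux.
- by move=> i; apply: IH (h3 i) => x Ux; exact: eq_partial Ux.
Qed.

Lemma is_derive_partial U k f i x : Ck_on U k.+1 f -> U x ->
  is_derive x (basis3 R i) f (partial i f x).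
Proof.
move=> h Ux; apply: derivableP; exact: Ck_on_derivable h Ux.
Qed.

Lemma partial_val f i x a : is_derive x (basis3 R i) f a -> partial i f x = a.
Proof. by move=> h; rewrite /partial derive_val. Qed.

Lemma partial_cst c i : partial i (cst c : X -> R) = cst 0.
Proof. by apply/funext => x; apply: partial_val. Qed.

Lemma Ck_on_cst U k c : Ck_on U k (cst c).
Proof.
elim: k c => [|k IH] c /=; first by move=> x _; exact: cst_continuous.
split.
- by move=> x _; exact: cst_continuous.
- by move=> i x _; exact: derivable_cst.
- by move=> i; rewrite partial_cst.
Qed.

Lemma Ck_onD U k f g : open U -> Ck_on U k f -> Ck_on U k g ->
  Ck_on U k (fun x => f x + g x).
Proof.
move=> oU; elim: k f g => [|k IH] f g.
  by move=> h1 h2 x Ux; apply: continuousD; [exact: h1|exact: h2].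
move=> /[dup] hf [h1 h2 h3] /[dup] hg [k1 k2 k3]; split.
- by move=> x Ux; apply: continuousD; [exact: h1|exact: k1].
- by move=> i x Ux; apply: derivableD; [exact: h2|exact: k2].
- move=> i; apply: (eq_Ck_on oU _ (IH _ _ (h3 i) (k3 i))) => x Ux.
  apply/esym/partial_val; apply: is_deriveD.
    exact: is_derive_partial hf Ux.
  exact: is_derive_partial hg Ux.
Qed.

Lemma Ck_onM U k f g : open U -> Ck_on U k f -> Ck_on U k g ->
  Ck_on U k (fun x => f x * g x).
Proof.
move=> oU; elim: k f g => [|k IH] f g.
  by move=> h1 h2 x Ux; apply: continuousM; [exact: h1|exact: h2].
move=> /[dup] hf [h1 h2 h3] /[dup] hg [k1 k2 k3]; split.
- by move=> x Ux; apply: continuousM; [exact: h1|exact: k1].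
- by move=> i x Ux; apply: derivableM; [exact: h2|exact: k2].
- move=> i; apply: (eq_Ck_on oU
    (f := fun x => f x * partial i g x + g x * partial i f x)).
    move=> x Ux; apply/esym/partial_val; apply: is_deriveM.
      exact: is_derive_partial hf Ux.
    exact: is_derive_partial hg Ux.
  by apply: Ck_onD oU (IH _ _ (Ck_onS hf) (k3 i)) (IH _ _ (Ck_onS hg) (h3 i)).
Qed.

Lemma Ck_onZ U k c f : open U -> Ck_on U k f -> Ck_on U k (fun x => c * f x).
Proof. by move=> oU hf; apply: Ck_onM => //; exact: Ck_on_cst. Qed.

Lemma Ck_onN U k f : open U -> Ck_on U k f -> Ck_on U k (fun x => - f x).
Proof.
move=> oU /(Ck_onZ (-1) oU); apply: eq_Ck_on => // x _; exact: mulN1r.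
Qed.

Lemma Ck_onB U k f g : open U -> Ck_on U k f -> Ck_on U k g ->
  Ck_on U k (fun x => f x - g x).
Proof. by move=> oU hf hg; apply: Ck_onD => //; exact: Ck_onN. Qed.

Lemma sum3E (V : nmodType) (F : 'I_3 -> V) :
  \sum_(i < 3) F i = F ord0 + F (lift ord0 ord0) + F ord_max.
Proof.
rewrite !big_ord_recr/= big_ord0 add0r.
by congr (F _ + F _ + F _); apply/val_inj.
Qed.

Lemma Ck_on_sum U k (F : 'I_3 -> X -> R) : open U ->
  (forall i, Ck_on U k (F i)) -> Ck_on U k (fun x => \sum_(i < 3) F i x).
Proof.
move=> oU hF.
under eq_fun do rewrite sum3E.
exact: Ck_onD oU (Ck_onD oU (hF _) (hF _)) (hF _).
Qed.

Lemma crdD i x y : crd i (x + y) = crd i x + crd i y.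
Proof. by rewrite /crd; case: (val i) => [|[|?]]. Qed.

Lemma crdZ i (a : R) x : crd i (a *: x) = a * crd i x.
Proof. by rewrite /crd; case: (val i) => [|[|?]]. Qed.

Lemma crd_inj x y : (forall i, crd i x = crd i y) -> x = y.
Proof.
case: x y => -[x0 x1] x2 [[y0 y1] y2] h.
by congr (_, _, _); [exact: (h ord0)|exact: (h (lift ord0 ord0))|
                     exact: (h ord_max)].
Qed.

Lemma crd_basis i j : crd i (basis3 R j) = (i == j)%:R.
Proof.
by rewrite /crd /basis3; case: i => -[|[|[|//]]] ?;
  case: j => -[|[|[|//]]] ?; rewrite /=.
Qed.

Lemma continuous_crd i : continuous (crd i : X -> R).
Proof.
rewrite /crd; case: (val i) => [|[|n]] x.
- apply: (@continuous_comp _ _ _ fst fst); exact: cvg_fst.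
- apply: (@continuous_comp _ _ _ fst snd); [exact: cvg_fst|exact: cvg_snd].
- exact: cvg_snd.
Qed.

Lemma is_derive_crd i j x :
  is_derive x (basis3 R i) (crd j : X -> R) (j == i)%:R.
Proof.
rewrite -crd_basis.
have q : (fun h => h^-1 *: ((crd j \o shift x) (h *: basis3 R i) - crd j x))
    @ 0^' --> crd j (basis3 R i).
  have c : (fun=> crd j (basis3 R i)) @ (0 : R)^' --> crd j (basis3 R i).
    exact: cvg_cst.
  apply: cvg_trans c.
  apply: near_eq_cvg; near=> h.
  rewrite /= crdD crdZ addrK /GRing.scale/= mulKf//.
  by near: h; exact: nbhs_dnbhs_neq.
split; last by apply: (cvg_lim _ q).
by apply/cvg_ex; exists (crd j (basis3 R i)).
Unshelve. all: by end_near. Qed.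

Lemma partial_crd i j : partial i (crd j : X -> R) = cst (j == i)%:R.
Proof. by apply/funext => x; apply/partial_val/is_derive_crd. Qed.

Lemma Ck_on_crd U k j : Ck_on U k (crd j).
Proof.
case: k => [|k] /=; first by move=> x _; exact: continuous_crd.
split.
- by move=> x _; exact: continuous_crd.
- by move=> i x _; have [] := is_derive_crd i j x.
- by move=> i; rewrite partial_crd; exact: Ck_on_cst.
Qed.

Lemma derive_pullback f x v :
  'D_v f x = 'D_1 (fun h : R => f (h *: v + x)) 0.
Proof.
rewrite /derive; set g1 := fun h => h^-1 *: _; set g2 := fun h => h^-1 *: _.
suff -> : g1 = g2 by [].
by rewrite funeqE /g1 /g2 => h /=; rewrite addr0 scale0r add0r [_%:A]mulr1.
Qed.

(** Along the line through [x] directed by [v] this is the chain rule in one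
  variable. *)
Lemma is_derive_comp1 (phi : R -> R) f x v a b :
  is_derive (f x) 1 phi a -> is_derive x v f b ->
  is_derive x v (phi \o f) (a * b).
Proof.
move=> hp hf; pose g (h : R) := f (h *: v + x).
have g0 : g 0 = f x by rewrite /g scale0r add0r.
have hg : is_derive (0 : R) 1 g b.
  case: hf => df <-; rewrite derive_pullback.
  by move/derivable1P in df; exact: derivableP df.
rewrite -g0 in hp.
have [d1 d2] := is_derive1_comp hp hg.
by split; [apply/derivable1P|rewrite derive_pullback].
Qed.

(** The derivatives are quantified existentially so that closed formulas valid
  only on [V] can be supplied for them. *)
Fixpoint Ck1_on (V : set R) (k : nat) (phi : R -> R) : Prop :=
  match k with
  | 0%N => forall t, V t -> {for t, continuous phi}
  | k'.+1 => exists2 phi', forall t, V t -> is_derive t 1 phi (phi' t)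
      & Ck1_on V k' phi'
  end.

Lemma is_derive_continuous (phi : R -> R) (t a : R) :
  is_derive t 1 phi a -> {for t, continuous phi}.
Proof. by case=> /derivable1_diffP /differentiable_continuous. Qed.

Lemma Ck1_on_continuous V k phi t :
  Ck1_on V k phi -> V t -> {for t, continuous phi}.
Proof.
case: k => [|k] /=; first by move=> h; exact: h.
by move=> [phi' h _] /h; exact: is_derive_continuous.
Qed.

Lemma Ck1_onS V k phi : Ck1_on V k.+1 phi -> Ck1_on V k phi.
Proof.
elim: k phi => [|k IH] phi.
  by move=> [phi' h _] t /h; exact: is_derive_continuous.
by move=> [phi' h1 h2]; exists phi' => //; exact: IH.
Qed.

Lemma Ck1_onD V k phi chi : Ck1_on V k phi -> Ck1_on V k chi ->
  Ck1_on V k (fun t => phi t + chi t).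
Proof.
elim: k phi chi => [|k IH] phi chi /=.
  by move=> h1 h2 t Vt; apply: continuousD; [exact: h1|exact: h2].
move=> [p h1 h2] [c k1 k2]; exists (fun t => p t + c t); last exact: IH.
by move=> t Vt; apply: is_deriveD; [exact: h1|exact: k1].
Qed.

Lemma Ck1_onM V k phi chi : Ck1_on V k phi -> Ck1_on V k chi ->
  Ck1_on V k (fun t => phi t * chi t).
Proof.
elim: k phi chi => [|k IH] phi chi.
  by move=> h1 h2 t Vt; apply: continuousM; [exact: h1|exact: h2].
move=> /[dup] hp [p h1 h2] /[dup] hc [c k1 k2].
exists (fun t => phi t * c t + chi t * p t).
  by move=> t Vt; apply: is_deriveM; [exact: h1|exact: k1].
by apply: Ck1_onD; apply: IH => //; exact: Ck1_onS.
Qed.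

Lemma Ck1_on_cst V k c : Ck1_on V k (cst c).
Proof.
elim: k c => [|k IH] c; first by move=> t _; exact: cst_continuous.
by exists (cst 0); [move=> t _; exact: is_derive_cst|exact: IH].
Qed.

Lemma Ck1_on_inv V k : (forall t, V t -> t != 0) -> Ck1_on V k (@GRing.inv R).
Proof.
move=> V0; elim: k => [|k IH].
  by move=> t Vt; apply: inv_continuous; exact: V0.
exists (fun t => (-1) * (t^-1 * t^-1)).
  move=> t Vt; have := @is_deriveV R id t 1 1 (V0 _ Vt) (is_derive_id _ _).
  by rewrite scaler1 mulN1r expr2 invfM.
by apply: Ck1_onM; [exact: Ck1_on_cst|exact: Ck1_onM].
Qed.

Lemma Ck_on_comp U V k phi f : open U -> Ck1_on V k phi -> Ck_on U k f ->
  (forall x, U x -> V (f x)) -> Ck_on U k (phi \o f).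
Proof.
move=> oU hp hf fV; elim: k phi f hp hf fV => [|k IH] phi f hp hf fV.
  by move=> x Ux; apply: continuous_comp; [exact: hf|exact/hp/fV].
move: (hp) (hf) => [p h1 h2] [k1 k2 k3]; split.
- move=> x Ux; apply: continuous_comp; first exact: k1.
  by apply: Ck1_on_continuous hp _; exact: fV.
- move=> i x Ux; have := is_derive_comp1 (h1 _ (fV _ Ux))
    (is_derive_partial i hf Ux).
  by case.
- move=> i; apply: (eq_Ck_on oU (f := fun x => (p \o f) x * partial i f x)).
    move=> x Ux; apply/esym/partial_val.
    by apply: is_derive_comp1 (is_derive_partial i hf Ux); exact/h1/fV.
  apply: Ck_onM (k3 i) => //; apply: IH h2 (Ck_onS hf) _ => x /fV //.
Qed.

Lemma Ck_onV U k f : open U -> Ck_on U k f -> (forall x, U x -> f x != 0) ->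
  Ck_on U k (fun x => (f x)^-1).
Proof.
move=> oU hf f0; apply: (Ck_on_comp oU (V := [set t | t != 0]) _ hf) => //.
by apply: Ck1_on_inv.
Qed.

End Calculus.

(** * Borel measurability in space *)

Section Measure.
Context {R : realType}.
Local Notation X := (R3 R).
Implicit Types (f g : X -> R) (i : 'I_3) (x : X).

Definition box3 (M : R) : set X := [set x | forall i, `|crd i x| <= M].

Lemma box3E M : box3 M =
  ([set t | - M <= t <= M] `*` [set t | - M <= t <= M]) `*`
    [set t | - M <= t <= M].
Proof.
apply/seteqP; split => [x h|x [[h0 h1] h2]] /=.
  do !split; rewrite -ler_norml.
  - exact: (h ord0).
  - exact: (h (lift ord0 ord0)).
  - exact: (h ord_max).
by rewrite /box3 /crd /= => -[[|[|[|//]]] ?]; rewrite /= ler_norml.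
Qed.

Lemma crd_ball x y e : (forall i, `|crd i x - crd i y| < e) -> ball x e y.
Proof.
move=> h; split; first split.
- rewrite -ball_normE; exact: (h ord0).
- rewrite -ball_normE; exact: (h (lift ord0 ord0)).
- rewrite -ball_normE; exact: (h ord_max).
Qed.

Lemma measurable_crd i : measurable_fun setT (crd i : mR3 R -> R).
Proof.
case: i => -[|[|[|//]]] i3 /=.
- exact: measurableT_comp measurable_fst measurable_fst.
- exact: measurableT_comp measurable_snd measurable_fst.
- exact: measurable_snd.
Qed.

(** Open sets are countable unions of cubes with rational centres and radii. *)
Lemma open_measurable3 (O : set X) : open O -> measurable (O : set (mR3 R)).
Proof.
move=> oO.
pose c (q : rat * rat * rat) : X := (ratr q.1.1, ratr q.1.2, ratr q.2).
pose B (q : rat * rat * rat * rat) : set (mR3 R) :=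
  [set x | forall i, `|crd i x - crd i (c q.1)| < ratr q.2].
pose F q := if `[< B q `<=` O >] then B q else set0.
have mB q : measurable (B q).
  have -> : B q = \bigcap_(i in [set: 'I_3])
      ((crd i : mR3 R -> R) @^-1` [set t | `|t - crd i (c q.1)| < ratr q.2]).
    by apply/seteqP; split => x h i; [move=> _; exact: h|exact: h].
  apply: fin_bigcap_measurable => // i _; rewrite -[X in measurable X]setTI.
  apply: measurable_crd => //.
  rewrite (_ : [set t | _] =
    `]crd i (c q.1) - ratr q.2, crd i (c q.1) + ratr q.2[%classic)//.
  by apply/seteqP; split => t /=; rewrite in_itv/= ltr_distl.
suff -> : O = \bigcup_q F q.
  apply: countable_bigcupT_measurable => // q.
  by rewrite /F; case: asboolP.
apply/seteqP; split => [x Ox|x [q _]]; last first.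
  by rewrite /F; case: asboolP => // BO /BO.
have [e e0 eO] : exists2 e : R, 0 < e & ball x e `<=` O.
  by have /nbhs_ballP[e /= e0 h] := open_nbhs_nbhs (conj oO Ox); exists e.
have [r] : exists r : rat, (0 : R) < ratr r < e / 2.
  have : 0 < e / 2 by lra.
  by move=> /rat_in_itvoo[r]; rewrite in_itv/= => h; exists r.
move=> /andP[r0 re].
have ap (t : R) : exists q : rat, `|t - ratr q| < ratr r.
  have : t - ratr r < t + ratr r by lra.
  move=> /rat_in_itvoo[q]; rewrite in_itv/= => /andP[h1 h2].
  by exists q; rewrite ltr_norml; apply/andP; split; lra.
have [q0 h0] := ap x.1.1; have [q1 h1] := ap x.1.2; have [q2 h2] := ap x.2.
exists (q0, q1, q2, r) => //.
have xB : B (q0, q1, q2, r) x by case=> -[|[|[|//]]] i3.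
rewrite /F; case: asboolP => // -[] y yB; apply: eO; apply: crd_ball => i.
have := yB i; have := xB i; rewrite /= !ltr_norml => /andP[? ?] /andP[? ?].
by apply/andP; split; lra.
Qed.

Lemma continuous_measurable3 (O : set X) f : open O ->
  (forall x, O x -> {for x, continuous f}) ->
  measurable_fun (O : set (mR3 R)) (f : mR3 R -> R).
Proof.
move=> oO cf mO; apply: (measurability _ (RGenOpens.measurableE R)) => //.
move=> _ [_ [a [b ->] <-]]; apply: open_measurable3.
rewrite openE => x [Ox fx]; apply: filterI.
  exact: (open_nbhs_nbhs (conj oO Ox)).
apply: cf => //; apply: open_nbhs_nbhs; split => //; exact: interval_open.
Qed.

Lemma measurable_box3 M : measurable (box3 M : set (mR3 R)).
Proof.
have mI : measurable ([set t : measurableTypeR R | - M <= t <= M]).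
  rewrite (_ : [set t | _] = `[- M, M]%classic).
    exact: measurable_itv.
  by apply/seteqP; split => t /=; rewrite in_itv.
by rewrite box3E; apply: measurableX => //; exact: measurableX.
Qed.

Lemma leb3_box3 M : (leb3 R (box3 M) < +oo)%E.
Proof.
have mI : measurable ([set t : measurableTypeR R | - M <= t <= M]).
  rewrite (_ : [set t | _] = `[- M, M]%classic).
    exact: measurable_itv.
  by apply/seteqP; split => t /=; rewrite in_itv.
have lI : (@lebesgue_measure R
    [set t : measurableTypeR R | (- M <= t <= M)%R] < +oo)%E.
  rewrite (_ : [set t | _] = `[- M, M]%classic).
    by rewrite lebesgue_measure_itv/=; case: ifP => //= _; rewrite -EFinD ltry.
  by apply/seteqP; split => t /=; rewrite in_itv.
rewrite box3E.
set I := [set t : measurableTypeR R | _] in mI lI *.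
pose l := @lebesgue_measure R.
have -> : leb3 R ((I `*` I) `*` I) = (l I * l I * l I)%E.
  rewrite -(product_measure1E l l mI mI).
  by apply: (product_measure1E _ l) => //; exact: measurableX.
have fI : lebesgue_measure I \is a fin_num by rewrite ge0_fin_numE.
by rewrite ltey_eq !fin_numM.
Qed.

End Measure.

(** * Integrals of compactly supported derivatives *)

Section PlaneMeasure.
Context {R : realType}.

(** The plane measure under a name of its own, to which a sigma-finiteness
  instance can be attached: Fubini's theorem is applied to it twice. *)
Definition leb2 : set (measurableTypeR R * measurableTypeR R)%type -> \bar R :=
  (@lebesgue_measure R \x @lebesgue_measure R)%E.

HB.instance Definition _ := Measure.copy leb2
  ((@lebesgue_measure R \x @lebesgue_measure R)%E).

Lemma leb2_sigma_finite : sigma_finite setT leb2.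
Proof.
pose I n : set (measurableTypeR R) := `[- n%:R, n%:R]%classic.
have mI n : measurable (I n) by exact: measurable_itv.
have lI n : @lebesgue_measure R (I n) \is a fin_num.
  by rewrite /I lebesgue_measure_itv/=; case: ifP.
exists (fun n => I n `*` I n) => [|n]; last first.
  split; first exact: measurableX.
  pose l := @lebesgue_measure R; rewrite /leb2 (product_measure1E l l)//.
  by rewrite ltey_eq fin_numM //; exact: lI.
apply/esym/seteqP; split=> // -[x y] _; pose n := (Num.truncn (`|x| + `|y|)).+1.
have xyn : `|x| + `|y| < n%:R by rewrite truncnS_gt.
exists n => //; split; rewrite /I /= in_itv/= -ler_norml.
  by apply: ltW; apply: le_lt_trans xyn; rewrite lerDl.
by apply: ltW; apply: le_lt_trans xyn; rewrite lerDr.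
Qed.

HB.instance Definition _ := Measure_isSigmaFinite.Build _ _ _ leb2
  leb2_sigma_finite.
End PlaneMeasure.

Section Integration.
Context {R : realType}.
Local Notation X := (R3 R).
Implicit Types (f g : X -> R) (i : 'I_3) (x : X).

Lemma integral_derivative_eq0 (h h' : R -> R) (N : R) :
  (forall t : R, is_derive t 1 h (h' t)) -> continuous h' ->
  (forall t, N < `|t| -> h t = 0) -> (forall t, N < `|t| -> h' t = 0) ->
  (\int[@lebesgue_measure R]_t (h' t)%:E = 0)%E.
Proof.
move=> hh' ch' h0 h'0; pose L : R := `|N| + 1.
have L0 : 0 < L by rewrite /L; have := normr_ge0 N; lra.
have NL : N < L by rewrite /L; have := ler_norm N; lra.
have ch : continuous h by move=> t; exact: is_derive_continuous (hh' t).
have -> : (\int[@lebesgue_measure R]_t (h' t)%:E =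
    \int[@lebesgue_measure R]_(t in `[(- L)%R, L]) (h' t)%:E)%E.
  rewrite [RHS]integral_mkcond; apply: eq_integral => t _ /=.
  rewrite patchE; case: ifPn => //; rewrite notin_setE /= in_itv/= => tL.
  congr (_%:E); apply: h'0; rewrite ltNge; apply/negP => tN; apply: tL.
  by rewrite -ler_norml (le_trans tN)// ltW.
rewrite (@continuous_FTC2 _ h' h).
- by rewrite !h0 ?subee// ?normrN gtr0_norm.
- lra.
- exact: continuous_subspaceT.
- split.
  + by move=> t _; have [] := hh' t.
  + by apply: cvg_at_right_filter; exact: ch.
  + by apply: cvg_at_left_filter; exact: ch.
- by move=> t _; rewrite derive1E; have [] := hh' t.
Qed.

Variables (Om : set X) (M : R).
Hypotheses (oOm : open Om) (OmM : Om `<=` box3 M).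

Lemma measurable_Om : measurable (Om : set (mR3 R)).
Proof. exact: open_measurable3. Qed.

Lemma leb3_Om : (leb3 R Om < +oo)%E.
Proof.
apply: le_lt_trans (leb3_box3 M); apply: le_measure; rewrite ?inE//.
  exact: measurable_Om.
exact: measurable_box3.
Qed.

(** Continuity is asked for on [Om] only, and boundedness replaces any further
  integrability condition, [Om] having finite measure. *)
Definition bcont f := (forall x, Om x -> {for x, continuous f}) /\
  exists B, forall x, Om x -> `|f x| <= B.

Definition csupp f := exists K : set X,
  [/\ compact K, K `<=` Om & forall x, ~ K x -> f x = 0].

Lemma bcont_cst c : bcont (cst c).
Proof. by split; [move=> x _; exact: cst_continuous|exists `|c|]. Qed.

Lemma bcontD f g : bcont f -> bcont g -> bcont (fun x => f x + g x).
Proof.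
move=> [cf [B fB]] [cg [C gC]]; split.
  by move=> x Ox; apply: continuousD; [exact: cf|exact: cg].
exists (B + C) => x Ox; rewrite (le_trans (ler_normD _ _))// lerD//.
  exact: fB.
exact: gC.
Qed.

Lemma bcontM f g : bcont f -> bcont g -> bcont (fun x => f x * g x).
Proof.
move=> [cf [B fB]] [cg [C gC]]; split.
  by move=> x Ox; apply: continuousM; [exact: cf|exact: cg].
by exists (B * C) => x Ox; rewrite normrM ler_pM// ?fB ?gC.
Qed.

Lemma bcontZ c f : bcont f -> bcont (fun x => c * f x).
Proof. by apply: bcontM; exact: bcont_cst. Qed.

Lemma bcontN f : bcont f -> bcont (fun x => - f x).
Proof.
move=> /(bcontZ (-1)); rewrite (_ : (fun x => _) = (fun x => - f x))//.
by apply/funext => x; rewrite mulN1r.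
Qed.

Lemma bcontB f g : bcont f -> bcont g -> bcont (fun x => f x - g x).
Proof. by move=> bf bg; apply: bcontD => //; exact: bcontN. Qed.

Lemma bcont_sum (F : 'I_3 -> X -> R) :
  (forall i, bcont (F i)) -> bcont (fun x => \sum_(i < 3) F i x).
Proof.
move=> bF; under eq_fun do rewrite sum3E.
exact: bcontD (bcontD (bF _) (bF _)) (bF _).
Qed.

Lemma bcont_measurable f : bcont f ->
  measurable_fun (Om : set (mR3 R)) (f : mR3 R -> R).
Proof. by case=> cf _; exact: continuous_measurable3. Qed.

Lemma bcont_integrable f : bcont f ->
  (leb3 R).-integrable (Om : set (mR3 R)) (EFin \o f).
Proof.
move=> bf; apply: measurable_bounded_integrable.
- exact: measurable_Om.
- exact: leb3_Om.
- exact: bcont_measurable.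
- case: bf => _ [B fB]; exists B; split; first exact: num_real.
  by move=> b Bb x Ox; apply: le_trans (fB x Ox) _; exact: ltW.
Qed.

Local Notation J f := (Rintegral (leb3 R) Om f).

Lemma integral_onD f g : bcont f -> bcont g ->
  J (fun x => f x + g x) = J f + J g.
Proof.
move=> bf bg; apply: RintegralD; first exact: measurable_Om.
  exact: bcont_integrable.
exact: bcont_integrable.
Qed.

Lemma integral_onZ c f : bcont f -> J (fun x => c * f x) = c * J f.
Proof.
move=> bf; apply: RintegralZl; first exact: measurable_Om.
exact: bcont_integrable.
Qed.

Lemma eq_integral_on f g : (forall x, Om x -> f x = g x) -> J f = J g.
Proof. by move=> fg; apply: eq_Rintegral => x; rewrite inE; exact: fg. Qed.

Lemma integral_onB f g : bcont f -> bcont g ->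
  J (fun x => f x - g x) = J f - J g.
Proof.
move=> bf bg; apply: RintegralB; first exact: measurable_Om.
  exact: bcont_integrable.
exact: bcont_integrable.
Qed.

Lemma integral_on_sum (F : 'I_3 -> X -> R) : (forall i, bcont (F i)) ->
  J (fun x => \sum_(i < 3) F i x) = \sum_(i < 3) J (F i).
Proof.
move=> bF; under eq_fun do rewrite sum3E.
rewrite (integral_onD (bcontD (bF _) (bF _)) (bF _)).
by rewrite (integral_onD (bF _) (bF _)) sum3E.
Qed.

Lemma integral_on_ge0 f : (forall x, Om x -> 0 <= f x) -> 0 <= J f.
Proof. by move=> f0; apply: Rintegral_ge0. Qed.

Lemma csupp_bcont f : (forall x, Om x -> {for x, continuous f}) -> csupp f ->
  bcont f.
Proof.
move=> cf [K [cK KO f0]]; split => //.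
have : compact (f @` K).
  apply: continuous_compact => //; apply: continuous_in_subspaceT => x.
  by rewrite inE => /KO; exact: cf.
move=> /compact_bounded[B [_ hB]].
exists (`|B| + 1) => x _; have [Kx|/f0 ->] := pselect (K x).
  by apply: (hB (`|B| + 1)); [have := ler_norm B; lra|exists x].
by rewrite normr0; have := normr_ge0 B; lra.
Qed.

Lemma csuppM f g : csupp f -> csupp (fun x => f x * g x).
Proof.
move=> [K [cK KO f0]]; exists K; split => // x /f0 ->; exact: mul0r.
Qed.

Lemma csuppMr f g : csupp g -> csupp (fun x => f x * g x).
Proof.
move=> [K [cK KO f0]]; exists K; split => // x /f0 ->; exact: mulr0.
Qed.

Lemma csuppD f g : csupp f -> csupp g -> csupp (fun x => f x + g x).
Proof.
move=> [K [cK KO f0]] [L [cL LO g0]]; exists (K `|` L); split.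
- exact: compactU.
- by move=> x [/KO|/LO].
- by move=> x /not_orP[/f0 -> /g0 ->]; exact: addr0.
Qed.

Lemma csuppN f : csupp f -> csupp (fun x => - f x).
Proof.
move=> [K [cK KO f0]]; exists K; split => // x /f0 ->; exact: oppr0.
Qed.

Lemma compact_openC (K : set X) : compact K -> open (~` K).
Proof. by move=> cK; apply: closed_openC; apply: compact_closed. Qed.

Lemma csupp_partial i f : csupp f -> csupp (partial i f).
Proof.
move=> [K [cK KO f0]]; exists K; split => // x Kx.
rewrite (@eq_partial _ (~` K) f (cst 0)) ?partial_cst//.
exact: compact_openC.
Qed.

(** The extension by zero is smooth because [Om] and the complement of the
  support are two open sets covering the space. *)
Lemma csupp_Ck k f : Ck_on Om k f -> csupp f -> Ck k f.
Proof.
move=> cf [K [cK KO f0]]; have oK := compact_openC cK.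
apply/Ck_onT; apply: (@Ck_on_sub _ _ (Om `|` ~` K)).
  by move=> x _; have [/KO|] := pselect (K x); [left|right].
apply: Ck_onU => //; apply: (eq_Ck_on oK (f := cst 0)).
  by move=> x /f0.
exact: Ck_on_cst.
Qed.

(** Extended by zero, [f] is differentiable on the whole space; Fubini's theorem
  integrates the partial derivative along its own direction first, where the
  fundamental theorem of calculus gives zero. *)
Lemma integral_partial_eq0 i f : Ck_on Om 1 f -> csupp f -> J (partial i f) = 0.
Proof.
move=> C1f sf; have := csupp_Ck C1f sf => /Ck_onT C1.
have sf' := csupp_partial i sf.
set g := partial i f in sf' *.
have cg x : {for x, continuous g}.
  by apply: (Ck_on_continuous (Ck_on_partial i C1)).
have z (h : X -> R) x : csupp h -> ~ box3 M x -> h x = 0.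
  by move=> [K [_ KO h0]] xM; apply: h0 => /KO/OmM.
have gE : EFin \o g = ((EFin \o g) \_ Om)%E.
  apply/funext => x /=; rewrite patchE; case: ifPn => //.
  case: sf' => K [_ KO g0]; rewrite notin_setE => Ox.
  by rewrite g0// => /KO.
have ig : (leb3 R).-integrable setT (EFin \o g).
  rewrite gE; apply/(integrable_mkcond _ measurable_Om).
  by apply: bcont_integrable; apply: csupp_bcont => // x _; exact: cg.
rewrite /Rintegral integral_mkcond -gE.
suff -> : (\int[leb3 R]_x (EFin \o g) x = 0)%E by [].
have line (c : X) : crd i c = 0 ->
    (\int[@lebesgue_measure R]_t (g (t *: basis3 R i + c))%:E = 0)%E.
  move=> ci; pose p (t : R) : X := t *: basis3 R i + c.
  have pE t : crd i (p t) = t.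
    by rewrite crdD crdZ crd_basis eqxx ci addr0 mulr1.
  have out t : M < `|t| -> ~ box3 M (p t).
    by move=> Mt /(_ i); rewrite pE leNgt Mt.
  have dp (t : R) : is_derive t 1 (f \o p) (g (p t)).
    have e :
      (fun h : R => h^-1 *: (((f \o p) \o shift t) (h *: 1) - (f \o p) t)) =
      (fun h => h^-1 *: ((f \o shift (p t)) (h *: basis3 R i) - f (p t))).
      apply/funext => h /=; congr (_ *: (f _ - _)).
      by rewrite /p [_%:A]mulr1 scalerDl addrA.
    have [df dv] := is_derive_partial i C1 (I : setT (p t)).
    split; first by rewrite /derivable e; exact: df.
    by rewrite /derive e.
  have cp : continuous p.
    move=> t.
    apply: (@continuousD _ _ _ (fun t : R => t *: basis3 R i) (cst c)).
      exact: scalel_continuous.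
    exact: cst_continuous.
  apply: (integral_derivative_eq0 (N := M) dp).
  - move=> t; apply: continuous_comp; [exact: cp|exact: cg].
  - by move=> t /out; exact: z.
  - by move=> t /out; exact: z.
have int0 d (T : measurableType d) (m : {measure set T -> \bar R})
  (F : T -> \bar R) : (forall t, F t = 0%E) -> (\int[m]_t F t = 0)%E.
  by move=> F0; apply: integral0_eq.
have ig3 : (leb2 \x @lebesgue_measure R)%E.-integrable setT (EFin \o g).
  exact: ig.
(* Only almost every horizontal slice is known to be integrable. *)
have slices : (forall z : R,
      leb2.-integrable setT (fun q => (EFin \o g) (q, z)) ->
      (\int[leb2]_q (EFin \o g) (q, z) = 0)%E) ->
    (\int[leb3 R]_x (EFin \o g) x = 0)%E.
  move=> G0; rewrite -(integral21_prod_meas1 ig3).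
  rewrite (@ae_eq_integral _ _ _ (@lebesgue_measure R) setT (cst 0%E))//.
  - exact: integral0.
  - exact: (measurable_fubini_G ig3).
  - by apply: filterS (ae_integrable2 ig3) => y iy _; exact: G0.
move: line; case: (i) => -[|[|[|//]]] i3 line.
- apply: slices => y iy; rewrite -(integral21_prod_meas1 iy); apply: int0 => x.
  apply: etrans (line ((0, x), y) (erefl _)); apply: eq_integral => t _.
  congr (g _)%:E; apply: crd_inj => -[[|[|[|//]]] j3];
    by rewrite crdD crdZ crd_basis /crd/= ?mulr0 ?mulr1 ?add0r ?addr0.
- apply: slices => y iy; rewrite -(integral12_prod_meas1 iy); apply: int0 => x.
  apply: etrans (line ((x, 0), y) (erefl _)); apply: eq_integral => t _.
  congr (g _)%:E; apply: crd_inj => -[[|[|[|//]]] j3];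
    by rewrite crdD crdZ crd_basis /crd/= ?mulr0 ?mulr1 ?add0r ?addr0.
- rewrite -(integral12_prod_meas1 ig3); apply: int0 => -[x y].
  apply: etrans (line ((x, y), 0) (erefl _)); apply: eq_integral => t _.
  congr (g _)%:E; apply: crd_inj => -[[|[|[|//]]] j3];
    by rewrite crdD crdZ crd_basis /crd/= ?mulr0 ?mulr1 ?add0r ?addr0.
Qed.

End Integration.

(** * A smooth step *)

Section Bump.
Context {R : realType}.

(** For [j = 0] a smooth step; the family is closed under differentiation up to
  linear combinations. *)
Definition flatexp (j : nat) (t : R) : R :=
  if 0 < t then t^-1 ^+ j * expR (- t^-1) else 0.

Lemma flatexp_ge0 j t : 0 <= flatexp j t.
Proof.
rewrite /flatexp; case: ifP => // t0.
by rewrite mulr_ge0 ?expR_ge0// exprn_ge0// invr_ge0 ltW.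
Qed.

Lemma flatexp_le j t : flatexp j t <= (j.+1)`!%:R * `|t|.
Proof.
rewrite /flatexp; case: ifP => [t0|_]; last by rewrite mulr_ge0.
have s0 : 0 < t^-1 by rewrite invr_gt0.
have f0 : 0 < (j.+1)`!%:R :> R by rewrite ltr0n fact_gt0.
have := expR_ge1Dxn j (ltW s0); rewrite expRN gtr0_norm// => h.
rewrite ler_pdivrMr ?expR_gt0//.
have -> : t^-1 ^+ j = (j.+1)`!%:R * t * (t^-1 ^+ j.+1 / (j.+1)`!%:R).
  by rewrite exprS; field; rewrite !gt_eqF.
by rewrite ler_wpM2l// ?mulr_ge0 1?ltW//; move: h; lra.
Qed.

Lemma flatexp_continuous0 j : {for 0, continuous (flatexp j)}.
Proof.
suff : flatexp j @ (0 : R) --> flatexp j 0 by [].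
have -> : flatexp j 0 = 0 by rewrite /flatexp ltxx.
apply: (@squeeze_cvgr _ _ _ _ (cst 0) (fun t => (j.+1)`!%:R * `|t|)).
- by near=> t; rewrite flatexp_ge0 flatexp_le.
- exact: (@cvg_cst _ (0 : R)).
- rewrite -[X in _ --> X](mulr0 ((j.+1)`!%:R : R)) -[X in _ * X](normr0 R).
  by apply: cvgMl_tmp; exact: norm_continuous.
Unshelve. all: by end_near. Qed.

Lemma is_derive_flatexp j (t : R) :
  is_derive t 1 (flatexp j) (- j%:R * flatexp j.+1 t + flatexp j.+2 t).
Proof.
have [t0|t0|->] := ltgtP t 0.
- rewrite /flatexp ltNge (ltW t0)/= mulr0 addr0.
  have := is_derive_cst (0 : R) (t : R) (1 : R).
  apply: near_eq_is_derive; near=> s; rewrite ltNge [X in ~~ X](_ : _ = true)//.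
  by apply: ltW; near: s; exact: lt_nbhsl.
- have d1 : is_derive t 1 (@GRing.inv R) (- t ^- 2).
    have := @is_deriveV R id t 1 1 (lt0r_neq0 t0) (is_derive_id _ _).
    by rewrite scaler1.
  have d2 : is_derive t 1 (fun s : R => expR (- s^-1))
      (t^-1 ^+ 2 * expR (- t^-1)).
    have d3 := @is_deriveN _ _ _ _ _ _ _ d1.
    have := is_derive1_comp (is_derive_expR _) d3.
    by rewrite opprK mulrC exprVn.
  have d4 := @is_deriveX _ _ _ j _ _ _ d1.
  have e : \forall s \near t,
      ((@GRing.inv R) ^+ j * (fun s => expR (- s^-1))) s = flatexp j s.
    near=> s; have s0 : 0 < s by near: s; exact: lt_nbhsr.
    by rewrite /flatexp s0 [LHS]/GRing.mul/= exprfctE.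
  have d5 := near_eq_is_derive e (@is_deriveM _ _ _ _ _ _ _ _ d4 d2).
  apply: (is_derive_eq d5); rewrite /flatexp t0 exprfctE /GRing.scale/=.
  case: (j) => [|n]; first by field; rewrite gt_eqF.
  by rewrite !exprS /=; field; rewrite gt_eqF.
(* At the origin the difference quotient is the next member of the family. *)
- apply/is_derive1_caratheodory; exists (flatexp j.+1); split.
  + move=> z; rewrite /flatexp ltxx !subr0.
    case: ifP => z0; last by rewrite mul0r.
    by rewrite exprS; field; rewrite gt_eqF.
  + exact: flatexp_continuous0.
  + by rewrite /flatexp ltxx mulr0 addr0.
Unshelve. all: by end_near. Qed.

Lemma Ck1_flatexp k j : Ck1_on setT k (flatexp j).
Proof.
elim: k j => [|k IH] j.
  by move=> t _; exact: is_derive_continuous (is_derive_flatexp j t).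
exists (fun t => - j%:R * flatexp j.+1 t + flatexp j.+2 t).
  by move=> t _; exact: is_derive_flatexp.
by apply: Ck1_onD => //; apply: Ck1_onM => //; exact: Ck1_on_cst.
Qed.

Lemma flatexp0_le1 t : flatexp 0 t <= 1.
Proof.
rewrite /flatexp; case: ifP => // t0.
by rewrite expr0 mul1r expR_le1 oppr_le0 invr_ge0 ltW.
Qed.

Lemma flatexp0_ge t : 0 < t -> 1 - t^-1 <= flatexp 0 t.
Proof. by move=> t0; rewrite /flatexp t0 expr0 mul1r expR_ge1Dx. Qed.

(** [flatexp 2] is the derivative of [flatexp 0]; these two bounds say that the
  scale-invariant derivative of the step is bounded and decays. *)
Lemma flatexp2_le t : 0 < t -> (t + 1) * flatexp 2 t <= t^-1 + t^-1 ^+ 2.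
Proof.
move=> t0; have s0 : 0 < t^-1 by rewrite invr_gt0.
have -> : (t + 1) * flatexp 2 t = (t^-1 + t^-1 ^+ 2) * expR (- t^-1).
  by rewrite /flatexp t0; field; rewrite gt_eqF.
by rewrite ler_piMr ?expR_le1 ?oppr_le0 ?ltW// addr_gt0 ?exprn_gt0.
Qed.

Lemma flatexp2_le3 t : (t + 1) * flatexp 2 t <= 3.
Proof.
have [t0|t0] := ltP 0 t; last by rewrite /flatexp ltNge t0/= mulr0.
have s0 : 0 < t^-1 by rewrite invr_gt0.
have -> : (t + 1) * flatexp 2 t = (t^-1 + t^-1 ^+ 2) / expR t^-1.
  by rewrite /flatexp t0 expRN; field; rewrite !gt_eqF// expR_gt0.
rewrite ler_pdivrMr ?expR_gt0//.
have := expR_ge1Dx t^-1; have := expR_ge1Dxn 1 (ltW s0).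
by rewrite (_ : 2`! = 2)%N//; lra.
Qed.

End Bump.

(** * Radial solutions of the Helmholtz equation *)

Section Profile.
Context {R : realType}.
Implicit Types (f g : R -> R) (s t : R).

Lemma is_derive1M f g t a b : is_derive t 1 f a -> is_derive t 1 g b ->
  is_derive t 1 (fun s => f s * g s) (f t * b + g t * a).
Proof. by move=> hf hg; exact: (@is_deriveM _ _ _ _ _ _ _ _ hf hg). Qed.

Lemma is_derive1D f g t a b : is_derive t 1 f a -> is_derive t 1 g b ->
  is_derive t 1 (fun s => f s + g s) (a + b).
Proof. by move=> hf hg; exact: (@is_deriveD _ _ _ _ _ _ _ _ _ hf hg). Qed.

Lemma is_derive1Z c f t a : is_derive t 1 f a ->
  is_derive t 1 (fun s => c * f s) (c * a).
Proof. by move=> hf; exact: (@is_deriveZ _ _ _ _ c _ _ _ hf). Qed.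

Lemma is_derive1V f t a : f t != 0 -> is_derive t 1 f a ->
  is_derive t 1 (fun s => (f s)^-1) (- (f t) ^- 2 * a).
Proof. by move=> f0 hf; exact: (is_deriveV f0 hf). Qed.

Lemma is_derive1_conv f g t a b : is_derive t 1 f a -> f =1 g -> a = b ->
  is_derive t 1 g b.
Proof. by move=> h /funext <- <-. Qed.

Variables (k th : R).

(** In the variable [s], the square of the distance to the origin, [Psi] is
  the radial solution of the Helmholtz equation in space with wave number [k]
  and phase [th]; [Psi1], [Psi2], [Psi3] are its derivatives in [s]. *)
Definition Psi s := sin (k * Num.sqrt s + th) / Num.sqrt s.

Definition Psi1 s :=
  (k * Num.sqrt s * cos (k * Num.sqrt s + th) - sin (k * Num.sqrt s + th)) /
  (2 * Num.sqrt s ^+ 3).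

Definition Psi2 s := - (k ^+ 2 * Psi s + 6 * Psi1 s) / (4 * s).

Definition Psi3 s := - (k ^+ 2 * Psi1 s + 10 * Psi2 s) / (4 * s).

Let dphase s : 0 < s ->
  is_derive s 1 (fun s => k * Num.sqrt s + th) (k * (2 * Num.sqrt s)^-1).
Proof.
move=> s0; apply: is_derive_eq.
  apply: is_derive1D (is_derive_cst th _ _).
  exact: is_derive1Z (is_derive1_sqrt s0).
exact: addr0.
Qed.

Lemma is_derive_Psi s : 0 < s -> is_derive s 1 Psi (Psi1 s).
Proof.
move=> s0; have r0 : 0 < Num.sqrt s by rewrite sqrtr_gt0.
have d := is_derive1_comp (is_derive_sin _) (dphase s0).
have := is_derive1M d (is_derive1V (lt0r_neq0 r0) (is_derive1_sqrt s0)).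
move/is_derive_eq; apply; rewrite /Psi1 /=; field.
by rewrite gt_eqF.
Qed.

Lemma is_derive_Psi1 s : 0 < s -> is_derive s 1 Psi1 (Psi2 s).
Proof.
move=> s0; have r0 : 0 < Num.sqrt s by rewrite sqrtr_gt0.
have sE : s = Num.sqrt s ^+ 2 by rewrite sqr_sqrtr// ltW.
have dS := is_derive1_comp (is_derive_sin _) (dphase s0).
have dC := is_derive1_comp (is_derive_cos _) (dphase s0).
have dr := is_derive1_sqrt s0.
have dN := is_derive1D (is_derive1M (is_derive1Z k dr) dC)
  (is_derive1Z (-1) dS).
have dD := is_derive1Z 2 (is_derive1M dr (is_derive1M dr dr)).
have D0 : 2 * (Num.sqrt s * (Num.sqrt s * Num.sqrt s)) != 0.
  by rewrite gt_eqF// !mulr_gt0.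
have dV := is_derive1V
  (f := fun s => 2 * (Num.sqrt s * (Num.sqrt s * Num.sqrt s))) D0 dD.
apply: (is_derive1_conv (is_derive1M dN dV)) => [t|].
  by rewrite /Psi1 /=; congr (_ / (2 * _)); rewrite mulN1r.
rewrite /Psi2 /Psi1 /Psi /=.
move: r0; set r := Num.sqrt s => r0.
rewrite [X in _ / (4 * X)]sE -/r; field.
by rewrite gt_eqF.
Qed.

Lemma is_derive_Psi2 s : 0 < s -> is_derive s 1 Psi2 (Psi3 s).
Proof.
move=> s0.
have dN := is_derive1D (is_derive1Z (k ^+ 2) (is_derive_Psi s0))
  (is_derive1Z 6 (is_derive_Psi1 s0)).
have D0 : 4 * s != 0 by rewrite gt_eqF// mulr_gt0.
have dD := is_derive1V (f := fun s => 4 * s) D0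
  (is_derive1Z 4 (is_derive_id s 1)).
apply: (is_derive1_conv (is_derive1Z (-1) (is_derive1M dN dD))) => [t|].
  by rewrite /Psi2 mulN1r mulNr.
rewrite /Psi3 /Psi2 /=; field.
by rewrite gt_eqF.
Qed.

(** In the variable [s] the Laplacian of a radial function [phi] is
  [4 s phi'' + 6 phi'], and that of [phi] times a coordinate is that coordinate
  times [4 s phi'' + 10 phi']. *)
Lemma Helmholtz_Psi s : 0 < s -> 4 * s * Psi2 s + 6 * Psi1 s = - k ^+ 2 * Psi s.
Proof. by move=> s0; rewrite /Psi2; field; rewrite gt_eqF. Qed.

Lemma Helmholtz_Psi1 s : 0 < s ->
  4 * s * Psi3 s + 10 * Psi2 s = - k ^+ 2 * Psi1 s.
Proof. by move=> s0; rewrite /Psi3; field; rewrite gt_eqF. Qed.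

(** The Helmholtz equation expresses the second derivative through [Psi] and
  [Psi1], so the pair is closed under differentiation. *)
Lemma Ck1_Psi n : Ck1_on [set s | 0 < s] n Psi /\ Ck1_on [set s | 0 < s] n Psi1.
Proof.
elim: n => [|n [IH0 IH1]].
  by split=> s s0; apply: is_derive_continuous;
    [exact: is_derive_Psi|exact: is_derive_Psi1].
split; first by exists Psi1 => //; exact: is_derive_Psi.
exists Psi2; first exact: is_derive_Psi1.
have -> : Psi2 = (fun s =>
    (cst (- k ^+ 2 / 4) s * Psi s + cst (- 6 / 4) s * Psi1 s) * s^-1).
  by apply/funext => s; rewrite /Psi2 invfM /=; ring.
apply: Ck1_onM; last by apply: Ck1_on_inv => s /lt0r_neq0.
by apply: Ck1_onD; apply: Ck1_onM => //; exact: Ck1_on_cst.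
Qed.


End Profile.

(** * Laplacians of products and of radial functions *)

Section Laplacian.
Context {R : realType}.
Local Notation X := (R3 R).
Implicit Types (f g : X -> R) (U : set X) (i j : 'I_3) (x : X).

Definition lap f x : R := \sum_(i < 3) partial i (partial i f) x.

Lemma partialD U i f g x : Ck_on U 1 f -> Ck_on U 1 g -> U x ->
  partial i (fun x => f x + g x) x = partial i f x + partial i g x.
Proof.
move=> hf hg Ux; apply: partial_val.
exact: (@is_deriveD _ _ _ _ _ _ _ _ _ (is_derive_partial i hf Ux)
  (is_derive_partial i hg Ux)).
Qed.

Lemma partialM U i f g x : Ck_on U 1 f -> Ck_on U 1 g -> U x ->
  partial i (fun x => f x * g x) x = f x * partial i g x + g x * partial i f x.
Proof.
move=> hf hg Ux; apply: partial_val.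
exact: (@is_deriveM _ _ _ _ _ _ _ _ (is_derive_partial i hf Ux)
  (is_derive_partial i hg Ux)).
Qed.

Lemma partialZ U i c f x : Ck_on U 1 f -> U x ->
  partial i (fun x => c * f x) x = c * partial i f x.
Proof.
move=> hf Ux; rewrite (partialM _ (Ck_on_cst U 1 c) hf Ux) partial_cst.
by rewrite mulr0 addr0.
Qed.

Lemma partialB U i f g x : open U -> Ck_on U 1 f -> Ck_on U 1 g -> U x ->
  partial i (fun x => f x - g x) x = partial i f x - partial i g x.
Proof.
move=> oU hf hg Ux.
rewrite (@eq_partial _ U _ (fun x => f x + (-1) * g x)) //; last first.
  by move=> y _; rewrite mulN1r.
by rewrite (partialD _ hf (Ck_onZ _ oU hg) Ux) (partialZ _ _ hg Ux) mulN1r.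
Qed.

Lemma partial2M U i f g x : open U -> Ck_on U 2 f -> Ck_on U 2 g -> U x ->
  partial i (partial i (fun x => f x * g x)) x =
  f x * partial i (partial i g) x + 2 * partial i f x * partial i g x +
  g x * partial i (partial i f) x.
Proof.
move=> oU hf hg Ux.
have hf1 := Ck_onS hf; have hg1 := Ck_onS hg.
have df := Ck_on_partial i hf; have dg := Ck_on_partial i hg.
rewrite (@eq_partial _ U _
  (fun x => f x * partial i g x + g x * partial i f x)) //;
  last by move=> y Uy; exact: partialM Uy.
rewrite (partialD _ (Ck_onM oU hf1 dg) (Ck_onM oU hg1 df) Ux).
by rewrite (partialM _ hf1 dg Ux) (partialM _ hg1 df Ux); ring.
Qed.

Lemma lapM U f g x : open U -> Ck_on U 2 f -> Ck_on U 2 g -> U x ->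
  lap (fun x => f x * g x) x =
  \sum_(i < 3) (f x * partial i (partial i g) x +
    2 * partial i f x * partial i g x + g x * partial i (partial i f) x).
Proof. by move=> oU hf hg Ux; apply: eq_bigr => i _; exact: partial2M Ux. Qed.

Lemma lapZ U c f x : open U -> Ck_on U 2 f -> U x ->
  lap (fun x => c * f x) x = c * lap f x.
Proof.
move=> oU hf Ux; rewrite /lap mulr_sumr; apply: eq_bigr => i _.
rewrite (@eq_partial _ U _ (fun x => c * partial i f x)) //;
  last by move=> y Uy; exact: partialZ (Ck_onS hf) Uy.
exact: partialZ (Ck_on_partial i hf) Ux.
Qed.

Lemma lapB U f g x : open U -> Ck_on U 2 f -> Ck_on U 2 g -> U x ->
  lap (fun x => f x - g x) x = lap f x - lap g x.
Proof.
move=> oU hf hg Ux; rewrite /lap -sumrB; apply: eq_bigr => i _.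
have hf1 := Ck_onS hf; have hg1 := Ck_onS hg.
rewrite (@eq_partial _ U _ (fun x => partial i f x - partial i g x)) //;
  last by move=> y Uy; exact: partialB Uy.
exact: partialB (Ck_on_partial i hf) (Ck_on_partial i hg) Ux.
Qed.

Lemma Ck_on_lap U k f : open U -> Ck_on U k.+2 f -> Ck_on U k (lap f).
Proof.
by move=> oU hf; apply: Ck_on_sum => // i; do 2 apply: Ck_on_partial.
Qed.

Definition sq x : R := \sum_(i < 3) crd i x ^+ 2.

Lemma sq_ge0 x : 0 <= sq x.
Proof. by apply: sumr_ge0 => i _; exact: sqr_ge0. Qed.

Lemma Ck_on_sq U k : open U -> Ck_on U k sq.
Proof.
move=> oU; apply: Ck_on_sum => // i.
apply: (eq_Ck_on oU (f := fun x => crd i x * crd i x)).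
  by move=> x _; rewrite expr2.
by apply: Ck_onM => //; exact: Ck_on_crd.
Qed.

Lemma is_derive_sq i x : is_derive x (basis3 R i) sq (2 * crd i x).
Proof.
have d j : is_derive x (basis3 R i) (fun x : X => crd j x * crd j x)
    (crd j x * (j == i)%:R + crd j x * (j == i)%:R).
  have dj := is_derive_crd i j x.
  exact: (@is_deriveM _ _ _ _ _ _ _ _ dj dj).
have := @is_derive_sum _ _ _ 3 _ _ _ _ d.
have -> : \sum_(j < 3) (fun x : X => crd j x * crd j x) = sq.
  by apply/funext => y; rewrite fct_sumE; apply: eq_bigr => j _; rewrite expr2.
move/is_derive_eq; apply; rewrite (bigD1 i)//= big1 => [|j /negbTE ->].
  by rewrite eqxx addr0 mulr1 mulr_natl mulr2n.
by rewrite mulr0 addr0.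
Qed.

Definition Xpos : set X := [set x | 0 < sq x].

Lemma open_sq (V : set R) : open V -> open (sq @^-1` V).
Proof.
move=> oV; apply: open_comp => // x _.
exact: (Ck_on_continuous (Ck_on_sq 0 openT) (I : setT x)).
Qed.

Lemma open_Xpos : open Xpos.
Proof. exact: (open_sq (@open_gt R 0)). Qed.

Lemma Ck_on_radial k (phi : R -> R) : Ck1_on [set s | 0 < s] k phi ->
  Ck_on Xpos k (fun x => phi (sq x)).
Proof.
move=> hp; apply: (Ck_on_comp open_Xpos hp) => //; apply: Ck_on_sq.
exact: open_Xpos.
Qed.

Lemma partial_radial (phi phi' : R -> R) i x :
  is_derive (sq x) 1 phi (phi' (sq x)) ->
  partial i (fun x => phi (sq x)) x = phi' (sq x) * (2 * crd i x).
Proof.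
by move=> h; apply: partial_val; exact: is_derive_comp1 (is_derive_sq i x).
Qed.

Section Radial.
Variables (phi phi' phi'' : R -> R).
Hypothesis C2 : Ck1_on [set s | 0 < s] 2 phi.
Hypothesis d1 : forall s : R, 0 < s -> is_derive s 1 phi (phi' s).
Hypothesis d2 : forall s : R, 0 < s -> is_derive s 1 phi' (phi'' s).

Let C1 : Ck1_on [set s | 0 < s] 1 phi'.
Proof.
case: C2 => p h1 [q h2 h3].
have pE s : 0 < s -> p s = phi' s.
  by move=> s0; have [_ <-] := h1 s s0; have [_ <-] := d1 s0.
have qE s : 0 < s -> q s = phi'' s.
  move=> s0; have [_ <-] := d2 s0; have [_ <-] := h2 s s0.
  apply: near_eq_derive; near=> t; apply: pE; near: t; exact: lt_nbhsr.
exists phi'' => // s s0; move: (h3 s s0).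
suff e : \forall t \near s, q t = phi'' t.
  move=> c; suff : phi'' @ s --> phi'' s by [].
  rewrite -qE//; apply: cvg_trans c; apply: near_eq_cvg.
  by apply: filterS e => t ->.
by near=> t; apply: qE; near: t; exact: lt_nbhsr.
Unshelve. all: by end_near. Qed.

Lemma partial2_radial i x : 0 < sq x ->
  partial i (partial i (fun x => phi (sq x))) x =
  2 * phi' (sq x) + 4 * crd i x ^+ 2 * phi'' (sq x).
Proof.
move=> x0.
rewrite (@eq_partial _ Xpos _ (fun x => phi' (sq x) * (2 * crd i x))) //.
- rewrite (@partialM Xpos i)//.
  + rewrite (@partialZ Xpos i)//; last exact: Ck_on_crd.
    by rewrite partial_crd eqxx (partial_radial i (d2 x0)) /=; ring.
  + exact: Ck_on_radial.
  + by apply: Ck_onZ; [exact: open_Xpos|exact: Ck_on_crd].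
- exact: open_Xpos.
- by move=> y y0; apply: partial_radial; exact: d1.
Qed.

Lemma lap_radial x : 0 < sq x ->
  lap (fun x => phi (sq x)) x = 4 * sq x * phi'' (sq x) + 6 * phi' (sq x).
Proof.
move=> x0; rewrite /lap (eq_bigr _ (fun i _ => partial2_radial i x0)).
rewrite big_split/= sumr_const card_ord -mulr_suml -mulr_sumr -/(sq x).
by rewrite -mulr_natl; ring.
Qed.

Lemma lap_radial_crd j x : 0 < sq x ->
  lap (fun x => phi (sq x) * crd j x) x =
  (4 * sq x * phi'' (sq x) + 10 * phi' (sq x)) * crd j x.
Proof.
move=> x0; rewrite (@lapM Xpos _ _ _ open_Xpos)//; last 2 first.
- exact: Ck_on_radial.
- exact: Ck_on_crd.
under eq_bigr => i _.
  rewrite partial_crd (partial_radial i (d1 x0)).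
  rewrite (_ : partial i (cst _) x = 0) ?partial_cst// mulr0 add0r.
  over.
rewrite big_split/= -mulr_sumr -/(lap _ x) lap_radial//.
rewrite (bigD1 j)//= big1 ?addr0 => [|i ij]; last first.
  by rewrite eq_sym (negbTE ij) mulr0.
by rewrite eqxx mulr1; ring.
Qed.

End Radial.

End Laplacian.

(** * Lower bounds for Friedrichs extensions *)

Section FormBound.
Context {R : realType} {E : lmodType R}.
Variables (ip : E -> E -> R) (L : set E).
Hypothesis LD : forall x y, L x -> L y -> L (x + y).
Hypothesis LZ : forall c x, L x -> L (c *: x).
Hypothesis ipC : forall x y, ip x y = ip y x.
Hypothesis ipDl : forall x y z, L x -> L y -> L z ->
  ip (x + y) z = ip x z + ip y z.
Hypothesis ipZl : forall c x y, L x -> L y -> ip (c *: x) y = c * ip x y.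
Hypothesis ip_ge0 : forall x, 0 <= ip x x.

Let LB x y : L x -> L y -> L (x - y).
Proof. by move=> Lx Ly; rewrite -scaleN1r; apply: LD => //; exact: LZ. Qed.

Let ipBl x y z : L x -> L y -> L z -> ip (x - y) z = ip x z - ip y z.
Proof.
move=> Lx Ly Lz; rewrite -scaleN1r ipDl ?ipZl ?mulN1r//; exact: LZ.
Qed.

Let ipBr x y z : L x -> L y -> L z -> ip z (x - y) = ip z x - ip z y.
Proof. by move=> Lx Ly Lz; rewrite !(ipC z) ipBl. Qed.

Lemma ip_Cauchy_Schwarz x y : L x -> L y -> ip x y ^+ 2 <= ip x x * ip y y.
Proof.
move=> Lx Ly.
have q t : 0 <= ip x x + 2 * t * ip x y + t ^+ 2 * ip y y.
  have Lt := LZ t Ly; have := ip_ge0 (x + t *: y).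
  rewrite ipDl// ?[ip x _]ipC ?[ip (t *: y) _]ipC; try exact: LD.
  rewrite !ipDl// ?ipZl// [ip x (t *: y)]ipC ipZl// [ip y (t *: y)]ipC ipZl//.
  by rewrite (ipC y x); lra.
have [y0|y0] := eqVneq (ip y y) 0.
  have [xy0|xy0] := eqVneq (ip x y) 0; first by rewrite xy0 y0; lra.
  have := q (- (ip x x + 1) / (2 * ip x y)).
  rewrite y0 (_ : 2 * _ * _ = - (ip x x + 1)); last by field.
  by rewrite mulr0; lra.
have y1 : 0 < ip y y by rewrite lt_def y0 ip_ge0.
have := q (- ip x y / ip y y).
rewrite (_ : _ + _ = ip x x - ip x y ^+ 2 / ip y y); last by field.
by rewrite subr_ge0 ler_pdivrMr.
Qed.

Variables (H D : set E) (T : E -> E) (c : R).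
Hypothesis HL : H `<=` L.
Hypothesis DL : D `<=` L.
Hypothesis TL : forall v, D v -> L (T v).
Hypothesis TB : forall v w, D v -> D w -> T (v - w) = T v - T w.
Hypothesis Tsym : forall v w, D v -> D w -> ip (T v) w = ip v (T w).
Hypothesis Tc : forall v, D v -> c * ip v v <= ip (T v) v.

(** Polarization expresses the form at two approximants by its values on the
  diagonal, where the hypothesis applies; letting the indices go to infinity one
  after the other then needs no continuity of the form itself. *)
Lemma friedrichs_eigenvalue_ge u l : ip u u != 0 ->
  friedrichs ip H D T u (l *: u) -> c <= l.
Proof.
move=> u0 [[Hu [v [Dv vu vC]]] _ uT].
have Lu := HL Hu; have Lv n := DL (Dv n); have LTv n := TL (Dv n).
have cvg_d z : L z -> ip (v n - u) z @[n --> \oo] --> (0 : R).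
  move=> Lz; apply/norm_cvg0P.
  apply: (@squeeze_cvgr _ _ _ _ (cst 0)
    (fun n => Num.sqrt (ip_dist2 ip (v n) u) * Num.sqrt (ip z z))).
  - near=> n; rewrite normr_ge0/= -sqrtr_sqr -sqrtrM; last exact: ip_ge0.
    by apply: ler_wsqrtr; apply: ip_Cauchy_Schwarz => //; exact: LB.
  - exact: (@cvg_cst _ (0 : R)).
  - rewrite -[X in _ --> X](mul0r (Num.sqrt (ip z z))) -[X in X * _]sqrtr0.
    apply: cvgM; last exact: cvg_cst.
    by apply: continuous_cvg => //; exact: sqrt_continuous.
have cvg_ip z : L z -> ip (v n) z @[n --> \oo] --> ip u z.
  move=> Lz.
  have -> : (fun n => ip (v n) z) = (fun n => ip (v n - u) z + ip u z).
    by apply/funext => n; rewrite ipBl// subrK.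
  rewrite -[X in _ --> X]add0r; apply: cvgD; [exact: cvg_d|exact: cvg_cst].
have cvg_nrm : ip (v n) (v n) @[n --> \oo] --> ip u u.
  have -> : (fun n => ip (v n) (v n)) =
      (fun n => ip_dist2 ip (v n) u + 2 * ip (v n - u) u + ip u u).
    apply/funext => n; rewrite /ip_dist2 [ip (v n - u) (v n - u)]ipBr//;
      last exact: LB.
    by rewrite !ipBl// (ipC u (v n)); ring.
  rewrite -[X in _ --> X](add0r (ip u u)) -[X in X + _](addr0 (0 : R)).
  rewrite -[X in _ + X + _](mulr0 (2 : R)).
  apply: cvgD; last exact: cvg_cst.
  by apply: cvgD => //; apply: cvgMl_tmp; exact: cvg_d.
have cvg_cnrm : c * ip (v n) (v n) @[n --> \oo] --> c * ip u u.
  by apply: cvgMl_tmp; exact: cvg_nrm.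
suff key e : 0 < e -> 2 * (c * ip u u) - e <= 2 * (l * ip u u).
  have u1 : 0 < ip u u by rewrite lt_def u0 ip_ge0.
  rewrite -(ler_pM2r u1) leNgt; apply/negP => lt.
  by have := key (c * ip u u - l * ip u u); rewrite subr_gt0 => /(_ lt); lra.
move=> e0; have [N hN] := vC e e0.
have step n : (N <= n)%N ->
    c * ip u u + (c * ip (v n) (v n) - e) <= 2 * (l * ip (v n) u).
  move=> Nn; have -> : l * ip (v n) u = ip u (T (v n)).
    by rewrite uT// ipZl// (ipC u).
  apply: (@ler_cvg_to nat \oo _ R
    (fun m => c * ip (v m) (v m) + (c * ip (v n) (v n) - e))
    (fun m => 2 * ip (v m) (T (v n)))).
  - by apply: cvgD; [exact: cvg_cnrm|exact: cvg_cst].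
  - by apply: cvgMl_tmp; exact: cvg_ip.
  - near=> m; have Nm : (N <= m)%N by near: m; exact: nbhs_infty_ge.
    have := hN m n Nm Nn; have := Tc (Dv m); have := Tc (Dv n).
    have Lmn := LB (Lv m) (Lv n).
    rewrite TB// ipBl// !ipBr// (Tsym (Dv m) (Dv n)) (ipC (T (v n)) (v m)).
    by lra.
apply: (@ler_cvg_to nat \oo _ R (fun n => c * ip u u + (c * ip (v n) (v n) - e))
  (fun n => 2 * (l * ip (v n) u))).
- have e2 : 2 * (c * ip u u) - e = c * ip u u + (c * ip u u - e) by ring.
  rewrite [X in _ --> X]e2; apply: cvgD; first exact: cvg_cst.
  by apply: cvgD; [exact: cvg_cnrm|exact: (@cvg_cst _ (- e))].
- by do 2 apply: cvgMl_tmp; exact: cvg_ip.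
- by near=> n; apply: step; near: n; exact: nbhs_infty_ge.
Unshelve. all: by end_near. Qed.

End FormBound.

(** * Energy identities *)

Section Energy.
Context {R : realType}.
Local Notation X := (R3 R).
Variables (Om : set X) (M : R).
Hypotheses (oOm : open Om) (OmM : Om `<=` box3 M).
Implicit Types (f g z w : X -> R) (i j : 'I_3) (x : X) (u v : field3 R).
Local Notation J f := (Rintegral (leb3 R) Om f).
Local Notation integral_onD := (integral_onD oOm OmM).
Local Notation integral_onB := (integral_onB oOm OmM).
Local Notation integral_onZ := (integral_onZ oOm OmM).
Local Notation integral_on_sum := (integral_on_sum oOm OmM).


Lemma csupp_sum (F : 'I_3 -> X -> R) : (forall i, csupp Om (F i)) ->
  csupp Om (fun x => \sum_(i < 3) F i x).
Proof.
move=> hF; under eq_fun do rewrite sum3E.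
exact: csuppD (csuppD (hF _) (hF _)) (hF _).
Qed.

Lemma csupp_lap f : csupp Om f -> csupp Om (lap f).
Proof. by move=> sf; apply: csupp_sum => i; do 2 apply: csupp_partial. Qed.

Lemma Ck_bcont k f : Ck_on Om k f -> csupp Om f -> bcont Om f.
Proof. by move=> hf; apply: csupp_bcont => x; exact: Ck_on_continuous hf. Qed.

Lemma integral_div_eq0 (F : 'I_3 -> X -> R) :
  (forall i, Ck_on Om 1 (F i)) -> (forall i, csupp Om (F i)) ->
  J (fun x => \sum_(i < 3) partial i (F i) x) = 0.
Proof.
move=> CF sF; rewrite integral_on_sum.
  by apply: big1 => i _; exact: (integral_partial_eq0 oOm OmM i (CF i) (sF i)).
by move=> i; apply: (Ck_bcont (Ck_on_partial i (CF i))); exact: csupp_partial.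
Qed.

(** Green's second identity: the vector field [f grad w - w grad f] has
  divergence [f lap w - w lap f]. *)
Lemma Green f w : Ck_on Om 2 f -> Ck_on Om 2 w -> csupp Om w ->
  J (fun x => f x * lap w x) = J (fun x => lap f x * w x).
Proof.
move=> hf hw sw; apply/eqP; rewrite -subr_eq0; apply/eqP.
have C0 h : Ck_on Om 2 h -> Ck_on Om 0 h by exact: Ck_on_le.
have cf := Ck_on_lap oOm hf; have cw := Ck_on_lap oOm hw.
rewrite -integral_onB; last 2 first.
- by apply: (Ck_bcont (Ck_onM oOm (C0 _ hf) cw)); apply/csuppMr/csupp_lap.
- by apply: (Ck_bcont (Ck_onM oOm cf (C0 _ hw))); exact: csuppMr.
have hf1 := Ck_onS hf; have hw1 := Ck_onS hw.
pose F i x := f x * partial i w x - w x * partial i f x.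
have df i := Ck_on_partial i hf; have dw i := Ck_on_partial i hw.
have CF i : Ck_on Om 1 (F i).
  exact: Ck_onB oOm (Ck_onM oOm hf1 (dw i)) (Ck_onM oOm hw1 (df i)).
rewrite -(@integral_div_eq0 F CF) => [|i]; last first.
  apply: csuppD; first by apply/csuppMr/csupp_partial.
  by apply/csuppN/csuppM.
apply: eq_integral_on => x Ox; rewrite /lap mulr_sumr mulr_suml -sumrB.
apply: eq_bigr => i _.
rewrite (partialB _ oOm (Ck_onM oOm hf1 (dw i)) (Ck_onM oOm hw1 (df i)) Ox).
rewrite (partialM _ hf1 (dw i) Ox) (partialM _ hw1 (df i) Ox).
move: (partial i (partial i w) x) (partial i (partial i f) x) => fii wii.
by move: (partial i w x) (partial i f x) => fi wi; ring.
Qed.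

(** Jacobi's ground state substitution: if [f] solves the Helmholtz equation
  then the Dirichlet energy of [z f] splits into the potential part and the
  energy of [z] weighted by [f ^+ 2]; the difference is the divergence of
  [z f ^+ 2 grad z]. *)
Lemma ground_state f z l : Ck_on Om 2 f -> Ck_on Om 2 z -> csupp Om z ->
  (forall x, Om x -> lap f x = - l * f x) ->
  J (fun x => - lap (fun y => z y * f y) x * (z x * f x)) =
  l * J (fun x => (z x * f x) ^+ 2) +
  J (fun x => \sum_(i < 3) (partial i z x * f x) ^+ 2).
Proof.
move=> hf hz sz lf.
have C0 h : Ck_on Om 2 h -> Ck_on Om 0 h by exact: Ck_on_le.
have hf1 := Ck_onS hf; have hz1 := Ck_onS hz.
have Czf := Ck_onM oOm hz hf.
have szf : csupp Om (fun x => z x * f x) by exact: csuppM.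
have b1 : bcont Om (fun x => (z x * f x) ^+ 2).
  under eq_fun do rewrite expr2.
  by have b := Ck_bcont Czf szf; exact: (bcontM b b).
have b2 : bcont Om (fun x => \sum_(i < 3) (partial i z x * f x) ^+ 2).
  apply: bcont_sum => i; under eq_fun do rewrite expr2.
  have C := Ck_onM oOm (Ck_on_partial i hz) hf1.
  by apply: bcontM; apply: (Ck_bcont C); apply/csuppM/csupp_partial.
pose F i x := (z x * (f x * f x)) * partial i z x.
have h2 := Ck_onM oOm hf1 hf1; have dz i := Ck_on_partial i hz.
have CF i : Ck_on Om 1 (F i) := Ck_onM oOm (Ck_onM oOm hz1 h2) (dz i).
have sF i : csupp Om (F i) by apply/csuppMr/csupp_partial.
have bF : bcont Om (fun x => \sum_(i < 3) partial i (F i) x).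
  apply: bcont_sum => i; apply: (Ck_bcont (Ck_on_partial i (CF i))).
  exact: csupp_partial.
have b3 := bcontZ l b1.
have /= eD := integral_onD b3 b2; have /= eB := integral_onB (bcontD b3 b2) bF.

have /= eZ := integral_onZ l b1.
rewrite -eZ -eD; apply: etrans (etrans eB _); last first.
  by rewrite (integral_div_eq0 CF sF) subr0.
apply: eq_integral_on => x Ox; rewrite (lapM oOm hz hf Ox).
have -> : l * (z x * f x) ^+ 2 = - lap f x * (z x ^+ 2 * f x).
  by rewrite lf//; ring.
rewrite -sumrN {1}/lap -sumrN !mulr_suml -big_split -sumrB/=.
apply: eq_bigr => i _.
rewrite (partialM _ (Ck_onM oOm hz1 h2) (dz i) Ox) (partialM _ hz1 h2 Ox).
rewrite (partialM _ hf1 hf1 Ox).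
move: (partial i (partial i z) x) (partial i (partial i f) x) => zii fii.
by move: (partial i z x) (partial i f x) => zi fi; ring.
Qed.

(** Barta's inequality: [ground_state] for the factor [z = v / f]. *)
Lemma energy_ge f (v : X -> R) l : Ck_on Om 2 f -> Ck_on Om 2 v -> csupp Om v ->
  (forall x, Om x -> 0 < f x) -> (forall x, Om x -> lap f x = - l * f x) ->
  l * J (fun x => v x ^+ 2) <= J (fun x => - lap v x * v x).
Proof.
move=> hf hv sv f0 lf; pose z x := v x * (f x)^-1.
have hz : Ck_on Om 2 z.
  apply: (Ck_onM oOm hv (Ck_onV oOm hf _)) => x Ox.
  exact: lt0r_neq0 (f0 x Ox).
have zf x : Om x -> z x * f x = v x.
  by move=> /f0 fx; rewrite /z mulfVK// gt_eqF.
have := ground_state hf hz (csuppM _ sv) lf.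
rewrite (@eq_integral_on _ _ (fun x => (z x * f x) ^+ 2)
  (fun x => v x ^+ 2)); last first.
  by move=> x /zf ->.
rewrite (@eq_integral_on _ _ (fun x => - lap _ x * _)
  (fun x => - lap v x * v x)) => [->|].
  rewrite lerDl; apply: integral_on_ge0 => x _.
  by apply: sumr_ge0 => i _; exact: sqr_ge0.
move=> x Ox; rewrite (zf x Ox).
suff -> : lap (fun y => z y * f y) x = lap v x by [].
apply: eq_bigr => i _.
apply: (eq_partial i oOm _ Ox) => y Oy; exact: (eq_partial i oOm zf Oy).
Qed.

Lemma laplacian3E v i x : (- laplacian3 v) i x = - lap (v i) x.
Proof. by []. Qed.

Lemma solenoidal_Ck k v i : solenoidal_c Om v -> Ck_on Om k (v i).
Proof.
by move=> [/(_ i)[C _] _]; apply: (@Ck_on_sub _ _ setT) => //; exact/Ck_onT.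
Qed.

Lemma solenoidal_csupp v i : solenoidal_c Om v -> csupp Om (v i).
Proof. by move=> [/(_ i)[_ [K hK]] _]; exists K. Qed.

Lemma solenoidal_bcont v i : solenoidal_c Om v -> bcont Om (v i).
Proof.
by move=> hv; exact: Ck_bcont (solenoidal_Ck 0 i hv) (solenoidal_csupp i hv).
Qed.

Lemma solenoidal_lap_bcont v i : solenoidal_c Om v -> bcont Om (lap (v i)).
Proof.
move=> hv; apply: (Ck_bcont (Ck_on_lap oOm (solenoidal_Ck 2 i hv))).
exact: csupp_lap (solenoidal_csupp i hv).
Qed.

Lemma stokes_energy_ge f v l : solenoidal_c Om v -> Ck_on Om 2 f ->
  (forall x, Om x -> 0 < f x) -> (forall x, Om x -> lap f x = - l * f x) ->
  l * L2_ip Om v v <= L2_ip Om (- laplacian3 v) v.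
Proof.
move=> hv hf f0 lf; have bv i := solenoidal_bcont i hv.
have bl i := solenoidal_lap_bcont i hv.
rewrite /L2_ip (integral_on_sum (fun i => bcontM (bv i) (bv i))).
rewrite [leRHS](integral_on_sum (fun i => bcontM (bcontN (bl i)) (bv i))).
rewrite mulr_sumr; apply: ler_sum => i _.
rewrite (@eq_integral_on _ _ (fun x => v i x * v i x) (fun x => v i x ^+ 2))
  => [|x _]; last by rewrite expr2.
exact: (energy_ge hf (solenoidal_Ck 2 i hv) (solenoidal_csupp i hv) f0 lf).
Qed.

Lemma stokes_Green u (w : field3 R) : (forall i, Ck_on Om 2 (u i)) ->
  (forall i, bcont Om (lap (u i))) -> (forall i, bcont Om (u i)) ->
  solenoidal_c Om w ->
  L2_ip Om u (- laplacian3 w) = L2_ip Om (- laplacian3 u) w.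
Proof.
move=> hu bl bu hw; have bw i := solenoidal_bcont i hw.
have sw i := solenoidal_csupp i hw; have Cw i := solenoidal_Ck 2 i hw.
have blw i := solenoidal_lap_bcont i hw.
rewrite /L2_ip (integral_on_sum (fun i => bcontM (bu i) (bcontN (blw i)))).
rewrite [RHS](integral_on_sum (fun i => bcontM (bcontN (bl i)) (bw i))).
apply: eq_bigr => i _.
transitivity (J (fun x => (-1) * (u i x * lap (w i) x))).
  by apply: eq_integral_on => x _; rewrite mulN1r -mulrN.
rewrite (integral_onZ _ (bcontM (bu i) (blw i))) (Green (hu i) (Cw i) (sw i)).
rewrite -(integral_onZ _ (bcontM (bl i) (bw i))).
by apply: eq_integral_on => x _; rewrite mulN1r -mulNr.
Qed.

Lemma laplacian3B v (w : field3 R) x : (forall i, Ck_on Om 2 (v i)) ->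
  (forall i, Ck_on Om 2 (w i)) -> Om x ->
  forall i, laplacian3 (v - w) i x = laplacian3 v i x - laplacian3 w i x.
Proof. by move=> hv hw Ox i; exact: (lapB oOm (hv i) (hw i) Ox). Qed.

End Energy.

(** * The Stokes form on square integrable fields *)

Section L2.
Context {R : realType}.
Local Notation X := (R3 R).
Variables (Om : set X) (M : R).
Hypotheses (oOm : open Om) (OmM : Om `<=` box3 M).
Implicit Types (f g : X -> R) (i : 'I_3) (x : X) (u v w : field3 R).
Local Notation J f := (Rintegral (leb3 R) Om f).
Local Notation mOm := (measurable_Om oOm).

Let intg f := (leb3 R).-integrable (Om : set (mR3 R)) (EFin \o f).

Let sqint f := measurable_fun (Om : set (mR3 R)) (f : mR3 R -> R) /\
  (leb3 R).-integrable Om (fun x => (f x ^+ 2)%:E).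

Let intgD f g : intg f -> intg g -> intg (fun x => f x + g x).
Proof. by move=> hf hg; exact: (integrableD mOm hf hg). Qed.

Let sqint_prod f g : sqint f -> sqint g -> intg (fun x => f x * g x).
Proof.
move=> [mf f2] [mg g2]; apply: (le_integrable mOm _ _ (intgD f2 g2)).
  by apply/measurable_EFinP; exact: measurable_funM.
move=> x _; rewrite /= lee_fin normrM [leRHS]ger0_norm ?addr_ge0 ?sqr_ge0//.
rewrite -(real_normK (num_real (f x))) -(real_normK (num_real (g x))).
by have := sqr_ge0 (`|f x| - `|g x|); have := normr_ge0 (f x);
  have := normr_ge0 (g x); nra.
Qed.

Let intgZ c f : intg f -> intg (fun x => c * f x).
Proof. by move=> hf; exact: (integrableZl mOm c hf). Qed.

Let L2_sqint u i : L2_3 Om u -> sqint (u i).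
Proof. by move=> /(_ i). Qed.

Lemma L2_3D u v : L2_3 Om u -> L2_3 Om v -> L2_3 Om (u + v).
Proof.
move=> hu hv i; have su := L2_sqint i hu; have sv := L2_sqint i hv.
split; first by apply: measurable_funD; [exact: su.1|exact: sv.1].
have := intgD (intgD su.2 sv.2) (intgZ 2 (sqint_prod su sv)).
rewrite /intg; congr (integrable _ _ _); apply/funext => x /=; congr (_%:E).
by rewrite sqrrD mulr2n mulrDl mul1r; lra.
Qed.

Lemma L2_3Z c u : L2_3 Om u -> L2_3 Om (c *: u).
Proof.
move=> hu i; have su := L2_sqint i hu; split.
  by apply: measurable_funM; [exact: measurable_cst|exact: su.1].
have := intgZ (c ^+ 2) su.2.
rewrite /intg; congr (integrable _ _ _).
by apply/funext => x /=; rewrite exprMn.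
Qed.

Lemma bcont_L2 u : (forall i, bcont Om (u i)) -> L2_3 Om u.
Proof.
move=> bu i; split; first exact: (bcont_measurable oOm).
have := bcont_integrable oOm OmM (bcontM (bu i) (bu i)).
by congr (integrable _ _ _); apply/funext => x /=; rewrite expr2.
Qed.

Let ip_int u v : L2_3 Om u -> L2_3 Om v ->
  intg (fun x => \sum_(i < 3) u i x * v i x).
Proof.
move=> hu hv; have h i := sqint_prod (L2_sqint i hu) (L2_sqint i hv).
have := intgD (intgD (h ord0) (h (lift ord0 ord0))) (h ord_max).
rewrite /intg; congr (integrable _ _ _); apply/funext => x /=.
by rewrite sum3E.
Qed.

Lemma L2_ipC u v : L2_ip Om u v = L2_ip Om v u.
Proof.
by apply: eq_integral_on => x _; apply: eq_bigr => i _; rewrite mulrC.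
Qed.

Lemma L2_ipDl u v w : L2_3 Om u -> L2_3 Om v -> L2_3 Om w ->
  L2_ip Om (u + v) w = L2_ip Om u w + L2_ip Om v w.
Proof.
move=> hu hv hw; rewrite /L2_ip -(RintegralD mOm (ip_int hu hw) (ip_int hv hw)).
apply: eq_integral_on => x _; rewrite -big_split/=.
by apply: eq_bigr => i _; rewrite mulrDl.
Qed.

Lemma L2_ipZl c u v : L2_3 Om u -> L2_3 Om v ->
  L2_ip Om (c *: u) v = c * L2_ip Om u v.
Proof.
move=> hu hv; rewrite /L2_ip -(RintegralZl c mOm (ip_int hu hv)).
apply: eq_integral_on => x _; rewrite mulr_sumr.
by apply: eq_bigr => i _; rewrite mulrA.
Qed.

Lemma L2_ip_ge0 u : 0 <= L2_ip Om u u.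
Proof.
apply: integral_on_ge0 => x _.
by apply: sumr_ge0 => i _; rewrite -expr2 sqr_ge0.
Qed.

Lemma solenoidal_L2 v : solenoidal_c Om v -> L2_3 Om v.
Proof. by move=> hv; apply: bcont_L2 => i; exact: solenoidal_bcont. Qed.

Lemma solenoidalZ c v : solenoidal_c Om v -> solenoidal_c Om (c *: v).
Proof.
move=> [hv dv]; have Cv i k : Ck_on setT k (v i).
  by apply/Ck_onT; exact: (hv i).1.
split=> [i|x].
  split.
    move=> k; apply/Ck_onT.
    by apply: (eq_Ck_on (@openT X) _ (Ck_onZ c (@openT X) (Cv i k))) => x _.
  have [_ [K [cK KO v0]]] := hv i; exists K; split => // x /v0 h.
  by rewrite [LHS](_ : _ = c * v i x)// h mulr0.
rewrite -(mulr0 c) -(dv x) /div3 mulr_sumr; apply: eq_bigr => i _.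
exact: (partialZ i c (Cv i 1%N) (I : setT x)).
Qed.

Lemma L2_sigmaZ c u : L2_sigma Om u -> L2_sigma Om (c *: u).
Proof.
move=> [Lu hu]; split=> [|e e0]; first exact: L2_3Z.
have c0 : 0 < c ^+ 2 + 1 by have := sqr_ge0 c; lra.
have [v sv duv] := hu (e / (c ^+ 2 + 1)) (divr_gt0 e0 c0).
exists (c *: v); first exact: solenoidalZ.
have Lvu : L2_3 Om (v - u).
  by rewrite -scaleN1r; apply: L2_3D (solenoidal_L2 sv) (L2_3Z _ Lu).
rewrite /ip_dist2 -scalerBr L2_ipZl//; last exact: L2_3Z.
rewrite L2_ipC L2_ipZl// mulrA -expr2.
move: duv; rewrite /ip_dist2 ltr_pdivlMr//; have := L2_ip_ge0 (v - u).
by move: (L2_ip Om _ _) => d; nra.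
Qed.

Lemma solenoidal_laplacianB v w : solenoidal_c Om v -> solenoidal_c Om w ->
  - laplacian3 (v - w) = - laplacian3 v - - laplacian3 w.
Proof.
move=> hv hw; have Cv i : Ck_on setT 2 (v i) by apply/Ck_onT; exact: (hv.1 i).1.
have Cw i : Ck_on setT 2 (w i) by apply/Ck_onT; exact: (hw.1 i).1.
have -> : laplacian3 (v - w) = laplacian3 v - laplacian3 w.
  apply/funext => i; apply/funext => x.
  exact: (@laplacian3B _ setT openT v w x Cv Cw I).
exact: opprD.
Qed.

Lemma solenoidal_laplacian_L2 v : solenoidal_c Om v -> L2_3 Om (- laplacian3 v).
Proof.
move=> hv; apply: bcont_L2 => i.
exact: bcontN (solenoidal_lap_bcont oOm i hv).
Qed.

(** On test fields the Stokes form is the sum over the components of the scalar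
  Dirichlet form, to which Barta's inequality applies. *)
Lemma stokes_eigenvalue_ge f c l : Ck_on Om 2 f ->
  (forall x, Om x -> 0 < f x) -> (forall x, Om x -> lap f x = - c * f x) ->
  eigenvalues (L2_ip Om) (stokes Om) l -> c <= l.
Proof.
move=> hf f0 lf [u u0 Su].
apply: (friedrichs_eigenvalue_ge (L := L2_3 Om)
  _ _ _ _ _ _ _ _ _ _ _ _ u0 Su).
- exact: L2_3D.
- exact: L2_3Z.
- exact: L2_ipC.
- exact: L2_ipDl.
- exact: L2_ipZl.
- exact: L2_ip_ge0.
- by move=> v [].
- exact: solenoidal_L2.
- exact: solenoidal_laplacian_L2.
- exact: solenoidal_laplacianB.
- move=> v w hv hw; apply/esym; apply: (stokes_Green oOm OmM) => [i|i|i|].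
  + exact: solenoidal_Ck.
  + exact: (solenoidal_lap_bcont oOm).
  + exact: solenoidal_bcont.
  + exact: hw.
- by move=> v hv; exact: (stokes_energy_ge oOm OmM hv hf f0 lf).
Qed.

End L2.

(** * Spherical shells and the lower bound *)

Section Convergence.
Context {R : realType}.
Local Notation X := (R3 R).
Variables (Om : set X) (M : R).
Hypotheses (oOm : open Om) (OmM : Om `<=` box3 M).
Local Notation J f := (Rintegral (leb3 R) Om f).

Lemma bounded_convergence0 (F : nat -> X -> R) (B : R) :
  (forall n, bcont Om (F n)) -> (forall n x, Om x -> `|F n x| <= B) ->
  (forall x, Om x -> F n x @[n --> \oo] --> (0 : R)) ->
  J (F n) @[n --> \oo] --> (0 : R).
Proof.
move=> bF FB F0.
have iB := bcont_integrable oOm OmM (bcont_cst Om B).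
have mOm := measurable_Om oOm.
have cF x : Om x -> (F n x)%:E @[n --> \oo] --> (0 : \bar R)%E.
  by move=> /F0 h; apply/fine_cvgP; split; [exact: nearW|exact: h].
have [| | | |_ _ h] := @dominated_convergence _ _ _ (leb3 R) Om mOm
  (fun n => EFin \o F n) (cst 0%E) (EFin \o cst B) _ _ _ iB.
- by move=> n; apply/measurable_EFinP; exact: (bcont_measurable oOm (bF n)).
- exact: measurable_cst.
- by apply: aeW => x Ox; exact: cF.
- by apply: aeW => x n Ox; rewrite /= lee_fin; exact: FB.
by move: h; rewrite integral0 => /fine_cvgP[].
Qed.

(** Otherwise a cube around [x0], which has positive measure, would be
  negligible. *)
Lemma integral_on_gt0 f x0 : bcont Om f -> (forall x, Om x -> 0 <= f x) ->
  Om x0 -> f x0 != 0 -> 0 < J f.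
Proof.
move=> bf f0 Ox0 fx0; rewrite lt_def integral_on_ge0// andbT.
apply/negP => /eqP Jf0.
have mOm := measurable_Om oOm; have intf := bcont_integrable oOm OmM bf.
have : (\int[leb3 R]_(x in Om) `|(f x)%:E| = 0)%E.
  transitivity (\int[leb3 R]_(x in Om) (EFin \o f) x)%E.
    by apply: eq_integral => x; rewrite inE => /f0 fx /=; rewrite ger0_norm.
  by rewrite -(fineK (integrable_fin_num mOm intf)) [fine _]Jf0.
move/(ae_eq_integral_abs _ mOm) => /(_ (measurable_int _ intf)) [N [mN N0 fN]].
have [e e0 eO] : exists2 e : R, 0 < e &
    ball x0 e `<=` Om `&` [set x | f x != 0].
  have : nbhs x0 (Om `&` [set x | f x != 0]).
    apply: filterI; first exact: open_nbhs_nbhs (conj oOm Ox0).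
    have n0 : nbhs (f x0) [set t | t != 0].
      by apply: open_nbhs_nbhs; split => //; exact: open_neq.
    exact: (bf.1 _ Ox0 _ n0).
  by move=> /nbhs_ballP[e /= e0 h]; exists e.
pose I (c : R) : set (measurableTypeR R) := `]c - e, c + e[%classic.
have mI c : measurable (I c) by exact: measurable_itv.
have lI c : @lebesgue_measure R (I c) = (2 * e)%:E.
  rewrite /I lebesgue_measure_itv/= lte_fin ifT; last lra.
  by rewrite -EFinB; congr (_%:E); ring.
pose Q : set (mR3 R) := (I x0.1.1 `*` I x0.1.2) `*` I x0.2.
have mQ : measurable Q by do !apply: measurableX => //.
have lQ : leb3 R Q = ((2 * e) * (2 * e) * (2 * e))%:E.
  transitivity (lebesgue_measure (I x0.1.1) * lebesgue_measure (I x0.1.2) *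
    lebesgue_measure (I x0.2))%E; last by rewrite !lI -!EFinM.
  pose l := @lebesgue_measure R.
  rewrite -(product_measure1E l l (mI _) (mI _)).
  by apply: (product_measure1E _ l) => //; exact: measurableX.
have QN : Q `<=` N.
  move=> x [[h1 h2] h3]; apply: fN => /= h.
  have [Ox /eqP fx] : (Om `&` [set x | f x != 0]) x.
    apply: eO; apply: crd_ball => i; rewrite distrC.
    move: h1 h2 h3; rewrite /I /= !in_itv/= -!ltr_distl /crd.
    by case: (val i) => [|[|?]].
  by have [] := h Ox.
have : (leb3 R Q <= 0)%E.
  apply: le_trans (le_measure (leb3 R) (mem_set mQ) (mem_set mN) QN) _.
  by rewrite [leLHS]N0.
by rewrite lQ lee_fin leNgt !mulr_gt0//; lra.
Qed.

End Convergence.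

Section Annulus.
Context {R : realType}.
Local Notation X := (R3 R).
Variables (A : R).
Hypothesis A0 : 0 < A.
Local Notation a := (A / 2).
Local Notation b := (1 + A / 2).
Local Notation Om := (annulus A).

Lemma annulusP x : annulus A x <-> a ^+ 2 < sq x < b ^+ 2.
Proof.
have a0 : 0 <= a by have := A0; lra.
have b0 : 0 <= b by have := A0; lra.
have s0 := sqrtr_ge0 (sq x); rewrite /annulus /= /enorm3 -/(sq x).
by rewrite -[in X in _ <-> X](sqr_sqrtr (sq_ge0 x)) !ltr_sqr ?nnegrE.
Qed.

Lemma open_annulus : open (annulus A).
Proof.
rewrite (_ : annulus A = sq @^-1` `]a ^+ 2, b ^+ 2[%classic).
  by apply: open_sq; exact: interval_open.
apply/seteqP; split => x /=; rewrite in_itv/=; first by move/annulusP.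
by move=> ?; exact/annulusP.
Qed.

Lemma sq_box x : sq x <= b ^+ 2 -> box3 b x.
Proof.
move=> xb i; have b0 : 0 <= b by have := A0; lra.
rewrite -ler_sqr ?nnegrE// real_normK ?num_real//; apply: le_trans xb.
by rewrite /sq (bigD1 i)//= lerDl; apply: sumr_ge0 => j _; exact: sqr_ge0.
Qed.

Lemma annulus_box : annulus A `<=` box3 b.
Proof. by move=> x /annulusP/andP[_ /ltW]; exact: sq_box. Qed.

Lemma annulus_Xpos : annulus A `<=` @Xpos R.
Proof.
by move=> x /annulusP/andP[+ _]; apply: le_lt_trans; rewrite sqr_ge0.
Qed.

Lemma Ck_on_Psi k l th : Ck_on Om k (fun x => Psi l th (sq x)).
Proof.
apply: (Ck_on_sub annulus_Xpos); apply: Ck_on_radial.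
exact: (Ck1_Psi l th k).1.
Qed.

Lemma lap_Psi l th x : Om x ->
  lap (fun x => Psi l th (sq x)) x = - l ^+ 2 * Psi l th (sq x).
Proof.
move=> /annulus_Xpos x0; rewrite -(Helmholtz_Psi _ _ x0).
apply: lap_radial => //; first exact: (Ck1_Psi l th 2).1.
- exact: is_derive_Psi.
- exact: is_derive_Psi1.
Qed.

(** The first radial Dirichlet function of a spherical shell of width one,
  [sin (pi (r - a)) / r], is positive with eigenvalue exactly [pi ^+ 2]. *)
Lemma annulus_eigenvalue_ge l :
  eigenvalues (L2_ip Om) (stokes Om) l -> pi ^+ 2 <= l.
Proof.
apply: (stokes_eigenvalue_ge open_annulus annulus_box
  (f := fun x => Psi pi (- (pi * a)) (sq x))).
- exact: Ck_on_Psi.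
- move=> x Ox; have := Ox; rewrite /annulus/= /enorm3 -/(sq x) => /andP[ar rb].
  have p0 := @pi_gt0 R; have A1 := A0.
  rewrite /Psi divr_gt0//; last by lra.
  apply: sin_gt0_pi; rewrite -mulrBr mulr_gt0//=; last by lra.
  by rewrite gtr_pMr//; lra.
- exact: lap_Psi.
Qed.

End Annulus.

(** * The toroidal eigenfield *)

Section Eigenfield.
Context {R : realType}.
Local Notation X := (R3 R).
Variables (A : R).
Hypothesis A0 : 0 < A.
Local Notation a := (A / 2).
Local Notation b := (1 + A / 2).
Local Notation Om := (annulus A).
Local Notation J f := (Rintegral (leb3 R) Om f).
Variables (k th : R).
Hypothesis qa : Psi1 k th (a ^+ 2) = 0.
Hypothesis qb : Psi1 k th (b ^+ 2) = 0.
Implicit Types (i j : 'I_3) (x : X).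

Local Notation oOm := (open_annulus A0).
Local Notation OmM := (annulus_box A0).

Definition rot_coef j : R := match val j with 0%N => 1 | 1%N => -1 | _ => 0 end.

Definition rot_idx j : 'I_3 :=
  match val j with 0%N => lift ord0 ord0 | _ => ord0 end.

(** The field [h (y, - x, 0)]; for radial [h] it is tangent to the spheres
  around the origin and solenoidal. *)
Definition rot_field (h : X -> R) : field3 R :=
  fun j x => rot_coef j * (h x * crd (rot_idx j) x).

(** Half of the cross product of [grad psi] with the vertical unit vector, for
  the radial Helmholtz function [psi] with profile [Psi k th]. *)
Definition eigenfield : field3 R := rot_field (fun x => Psi1 k th (sq x)).

Lemma Ck_on_rot (U : set X) n h j : open U -> Ck_on U n h ->
  Ck_on U n (rot_field h j).
Proof.
by move=> oU hh; exact: Ck_onZ _ oU (Ck_onM oU hh (Ck_on_crd U n (rot_idx j))).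
Qed.

Lemma Ck_on_Psi1 n : Ck_on Om n (fun x => Psi1 k th (sq x)).
Proof.
exact: Ck_on_sub (annulus_Xpos A0) (Ck_on_radial (Ck1_Psi k th n).2).
Qed.

Lemma Ck_on_eigenfield n j : Ck_on Om n (eigenfield j).
Proof. exact: Ck_on_rot oOm (Ck_on_Psi1 n). Qed.

Lemma lap_eigenfield j x : Om x ->
  lap (eigenfield j) x = - k ^+ 2 * eigenfield j x.
Proof.
move=> Ox; have x0 := annulus_Xpos A0 Ox.
have C := Ck_onM oOm (Ck_on_Psi1 2) (Ck_on_crd Om 2 (rot_idx j)).
rewrite (lapZ _ oOm C Ox) (lap_radial_crd (Ck1_Psi k th 2).2
  (@is_derive_Psi1 _ k th) (@is_derive_Psi2 _ k th) _ x0).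
by rewrite Helmholtz_Psi1// /eigenfield /rot_field; ring.
Qed.

(** Both boundary values vanish, so the profile is controlled by the product of
  the distances to the two ends; this is what makes the cutoff harmless. *)
Lemma Psi1_le : exists2 C, 0 <= C & forall s, a ^+ 2 <= s <= b ^+ 2 ->
  `|Psi1 k th s| <= C * ((s - a ^+ 2) * (b ^+ 2 - s)).
Proof.
have a0 : 0 < a ^+ 2 by rewrite exprn_gt0//; have := A0; lra.
have ab : a ^+ 2 < b ^+ 2.
  by rewrite ltr_sqr ?nnegrE; have := A0; lra.
have pos s : a ^+ 2 <= s -> 0 < s by exact: lt_le_trans.
have cq2 : {within `[a ^+ 2, b ^+ 2], continuous (Psi2 k th)}.
  apply: continuous_in_subspaceT => s.
  rewrite inE/= in_itv/= => /andP[/pos s0 _].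
  exact: is_derive_continuous (is_derive_Psi2 k th s0).
have cq1 c d : a ^+ 2 <= c -> {within `[c, d], continuous (Psi1 k th)}.
  move=> ac; apply: continuous_in_subspaceT => s.
  rewrite inE/= in_itv/= => /andP[/(le_trans ac)/pos s0 _].
  exact: is_derive_continuous (is_derive_Psi1 k th s0).
have [B B0 hB] : exists2 B, 0 <= B &
    forall s, a ^+ 2 <= s <= b ^+ 2 -> `|Psi2 k th s| <= B.
  have : compact (Psi2 k th @` `[a ^+ 2, b ^+ 2]).
    by apply: continuous_compact => //; exact: segment_compact.
  move=> /compact_bounded[B [_ hB]]; exists (`|B| + 1).
    by have := normr_ge0 B; lra.
  move=> s sab; apply: (hB (`|B| + 1)); first by have := ler_norm B; lra.
  by exists s => //=; rewrite in_itv.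
have mvt c d : a ^+ 2 <= c -> c <= d -> d <= b ^+ 2 ->
    `|Psi1 k th d - Psi1 k th c| <= B * (d - c).
  move=> ac cd db.
  have [|e] := @MVT_segment _ (Psi1 k th) (Psi2 k th) c d cd _ (cq1 _ _ ac).
    move=> s; rewrite in_itv/= => /andP[/ltW/(le_trans ac)/pos s0 _].
    exact: is_derive_Psi1.
  rewrite in_itv/= => /andP[ce ed] ->.
  rewrite normrM (ger0_norm (_ : 0 <= d - c)) ?subr_ge0// ler_wpM2r ?subr_ge0//.
  by apply: hB; rewrite (le_trans ac ce) (le_trans ed db).
have w0 : 0 < b ^+ 2 - a ^+ 2 by rewrite subr_gt0.
exists (2 * B / (b ^+ 2 - a ^+ 2)); first by rewrite divr_ge0 ?mulr_ge0// ltW.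
move=> s /andP[as_ sb]; rewrite mulrAC ler_pdivlMr//.
have h1 := mvt _ _ (lexx _) as_ sb; rewrite qa subr0 in h1.
have h2 := mvt _ _ as_ sb (lexx _); rewrite qb sub0r normrN in h2.
have p1 : 0 <= s - a ^+ 2 by rewrite subr_ge0.
have p2 : 0 <= b ^+ 2 - s by rewrite subr_ge0.
move: (a ^+ 2) (b ^+ 2) `|Psi1 k th s| h1 h2 p1 p2 => a2 b2 q h1 h2 p1 p2.
have -> : b2 - a2 = (s - a2) + (b2 - s) by ring.
have m1 : q * (b2 - s) <= B * (s - a2) * (b2 - s) by rewrite ler_wpM2r.
have m2 : q * (s - a2) <= B * (b2 - s) * (s - a2) by rewrite ler_wpM2r.
by move: m1 m2; lra.
Qed.

(** A polynomial defining function of the shell. *)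
Definition wall x : R := (sq x - a ^+ 2) * (b ^+ 2 - sq x).

Lemma wall_gt0 x : Om x -> 0 < wall x.
Proof. by move=> /(annulusP A0)/andP[h1 h2]; rewrite mulr_gt0// subr_gt0. Qed.

Lemma wall_le x : Om x -> wall x <= b ^+ 2 * b ^+ 2.
Proof.
move=> /(annulusP A0)/andP[h1 h2]; have := sqr_ge0 a; have := sq_ge0 x.
rewrite /wall; move: (sq x) (a ^+ 2) (b ^+ 2) h1 h2 => s a2 b2 h1 h2 s0 a0.
by apply: ler_pM; lra.
Qed.

Lemma wall_gt0_annulus x : 0 < wall x -> Om x.
Proof.
move=> w0; apply/(annulusP A0).
have ab : a ^+ 2 < b ^+ 2 by rewrite ltr_sqr ?nnegrE; have := A0; lra.
have [h1|h1] := ltP (a ^+ 2) (sq x); have [h2|h2] := ltP (sq x) (b ^+ 2) => //.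
- have : wall x <= 0 by apply: mulr_ge0_le0; rewrite ?subr_ge0 ?subr_le0// ltW.
  by rewrite leNgt w0.
- have : wall x <= 0 by apply: mulr_le0_ge0; rewrite ?subr_ge0 ?subr_le0// ltW.
  by rewrite leNgt w0.
- by have := lt_le_trans ab (le_trans h2 h1); rewrite ltxx.
Qed.

Lemma eigenfield_le : exists2 C, 0 <= C & forall j x, Om x ->
  `|eigenfield j x| <= C * wall x.
Proof.
have [C C0 hC] := Psi1_le; have b0 : 0 <= b by have := A0; lra.
exists (b * C) => [|j x Ox]; first exact: mulr_ge0.
have /(annulusP A0)/andP[/ltW h1 /ltW h2] := Ox.
have c1 : `|rot_coef j| <= 1.
  rewrite /rot_coef.
  by case: (val j) => [|[|?]]; rewrite ?normr1 ?normrN1 ?normr0.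
have hq := hC (sq x); rewrite h1 h2 /= in hq; have {}hq := hq isT.
rewrite /eigenfield /rot_field normrM [`|_ * crd _ _|]normrM.
have -> : b * C * wall x = 1 * (C * wall x * b) by ring.
apply: ler_pM => //.
by apply: ler_pM => //; exact: (annulus_box A0 Ox).
Qed.

Lemma bcont_eigenfield j : bcont Om (eigenfield j).
Proof.
split; first by move=> x Ox; exact: Ck_on_continuous (Ck_on_eigenfield 0 j) Ox.
have [C C0 hC] := eigenfield_le; exists (C * (b ^+ 2 * b ^+ 2)) => x Ox.
by apply: le_trans (hC j x Ox) _; apply: ler_wpM2l => //; exact: wall_le.
Qed.

End Eigenfield.

(** * Cutoffs near the boundary *)

Section Cutoff.
Context {R : realType}.
Local Notation X := (R3 R).
Variables (A : R).
Hypothesis A0 : 0 < A.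
Local Notation a := (A / 2).
Local Notation b := (1 + A / 2).
Local Notation Om := (annulus A).
Implicit Types (i j : 'I_3) (x : X) (n : nat).

Local Notation oOm := (open_annulus A0).
Local Notation OmM := (annulus_box A0).

Lemma compact_box3 (M : R) : compact (box3 M : set X).
Proof.
have cI : compact [set t : R | - M <= t <= M].
  rewrite (_ : [set t | _] = `[- M, M]%classic); first exact: segment_compact.
  by apply/seteqP; split => t /=; rewrite in_itv.
by rewrite box3E; do !apply: compact_setX.
Qed.

Lemma Ck_on_wall n (U : set X) : open U -> Ck_on U n (wall A).
Proof.
move=> oU; have Cs := Ck_on_sq n oU.
exact: Ck_onM oU (Ck_onB oU Cs (Ck_on_cst U n (a ^+ 2)))
  (Ck_onB oU (Ck_on_cst U n (b ^+ 2)) Cs).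
Qed.

Definition wall_grad x : R := 2 * (a ^+ 2 + b ^+ 2 - 2 * sq x).

Lemma partial_wall i x : partial i (wall A) x = wall_grad x * crd i x.
Proof.
have Cs := Ck_on_sq 1 (@openT X); have Cc c := Ck_on_cst (@setT X) 1 c.
have C1 := Ck_onB (@openT X) Cs (Cc (a ^+ 2)).
have C2 := Ck_onB (@openT X) (Cc (b ^+ 2)) Cs.
rewrite (partialM i C1 C2 I) (partialB i (@openT X) Cs (Cc _) I).
rewrite (partialB i (@openT X) (Cc _) Cs I) !partial_cst.
by rewrite (partial_val (is_derive_sq i x)) /wall_grad /=; ring.
Qed.

Lemma wall_grad_le : exists2 C, 0 <= C & forall i x, Om x ->
  `|wall_grad x * crd i x| <= C.
Proof.
have b0 : 0 <= b by have := A0; lra.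
exists (2 * b ^+ 2 * b) => [|i x Ox]; first by rewrite !mulr_ge0// sqr_ge0.
have /(annulusP A0)/andP[/ltW h1 /ltW h2] := Ox.
rewrite normrM ler_pM//; last exact: (annulus_box A0 Ox).
rewrite /wall_grad normrM ger0_norm// ler_wpM2l//.
move: (sqr_ge0 a) (sqr_ge0 b).
move: (sq x) (a ^+ 2) (b ^+ 2) h1 h2 => s a2 b2 h1 h2 a20 b20.
by rewrite ler_norml; apply/andP; split; lra.
Qed.

(** Smooth cutoffs with values between 0 and 1 that vanish where
  [n * wall A <= 1] and increase to 1 inside the shell; their gradients are of
  order [n], but only at a depth of order [1 / n]. *)
Definition cutoff n x : R := flatexp 0 (n%:R * wall A x - 1).

Let Ck_arg n m (U : set X) : open U -> Ck_on U m (fun x => n%:R * wall A x - 1).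
Proof.
move=> oU.
exact: Ck_onB oU (Ck_onZ _ oU (Ck_on_wall m oU)) (Ck_on_cst U m 1).
Qed.

Lemma Ck_on_cutoff n m (U : set X) : open U -> Ck_on U m (cutoff n).
Proof.
by move=> oU; apply: (Ck_on_comp oU (Ck1_flatexp m 0) (Ck_arg n m oU)).
Qed.

Lemma partial_cutoff n i x : partial i (cutoff n) x =
  flatexp 2 (n%:R * wall A x - 1) * n%:R * (wall_grad x * crd i x).
Proof.
have d := is_derive_partial i (Ck_arg n 1 (@openT X)) (I : setT x).
rewrite (partial_val (is_derive_comp1 (is_derive_flatexp 0 _) d)).
have Cw := Ck_on_wall 1 (@openT X).
rewrite (partialB i (@openT X) (Ck_onZ _ (@openT X) Cw) (Ck_on_cst _ 1 1) I).
rewrite (partialZ i _ Cw I) partial_cst partial_wall /=.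
by rewrite oppr0 mul0r add0r; ring.
Qed.

Lemma csupp_cutoff n : csupp Om (cutoff n).
Proof.
pose K : set X := [set x | 1 <= n%:R * wall A x].
have Kw x : K x -> 0 < wall A x.
  rewrite /K /= => h; rewrite ltNge; apply/negP => w0.
  by have := mulr_ge0_le0 (ler0n R n) w0; lra.
exists K; split.
- apply: (@subclosed_compact _ K (box3 b)); last 2 first.
  + exact: compact_box3.
  + by move=> x /Kw /(wall_gt0_annulus A0) /OmM.
  + have cw : continuous (fun x => n%:R * wall A x).
      have C0 := Ck_onZ n%:R (@openT X) (Ck_on_wall 0 (@openT X)).
      by move=> x; exact: Ck_on_continuous C0 I.
    apply: (@closed_comp _ _ (fun x => n%:R * wall A x) [set t | 1 <= t]).
      by move=> x _; exact: cw.
    exact: closed_ge.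
- by move=> x /Kw; exact: wall_gt0_annulus.
- move=> x /negP; rewrite -ltNge /cutoff /flatexp subr_gt0 => /ltW.
  by rewrite leNgt => /negbTE ->.
Qed.

Lemma cutoff_ge0 n x : 0 <= cutoff n x. Proof. exact: flatexp_ge0. Qed.

Lemma cutoff_le1 n x : cutoff n x <= 1. Proof. exact: flatexp0_le1. Qed.

(** The gradient of [h] is radial, and the field is tangent to the spheres. *)
Lemma div_rot_field (U : set X) h g x : Ck_on U 1 h -> U x ->
  (forall i, partial i h x = g * crd i x) -> div3 (rot_field h) x = 0.
Proof.
move=> hh Ux hg.
have E i : partial i (rot_field h i) x =
    (rot_coef i : R) * (crd (rot_idx i) x * (g * crd i x)).
  have Cc := Ck_on_crd U 1 (rot_idx i).
  have d := is_derive_partial i hh Ux; have dc := is_derive_partial i Cc Ux.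
  rewrite /rot_field (partial_val (@is_deriveZ _ _ _ _ ((rot_coef i : R)) _ _ _
    (@is_deriveM _ _ _ _ _ _ _ _ d dc))).
  rewrite hg partial_crd /GRing.scale/=.
  by case: i {d dc Cc} => -[|[|[|//]]] ?;
    rewrite /rot_coef/= ?mulr0 ?add0r ?mul0r.
rewrite /div3 (eq_bigr _ (fun i _ => E i)) sum3E.
rewrite /rot_coef /rot_idx /crd /=; ring.
Qed.

Section Approximants.
Variables (k th : R).

Definition cut_field n : field3 R :=
  rot_field (fun x => cutoff n x * Psi1 k th (sq x)).

Lemma cut_fieldE n j x : cut_field n j x = cutoff n x * eigenfield k th j x.
Proof. by rewrite /cut_field /eigenfield /rot_field; ring. Qed.

Let csupp_cut_field n j : csupp Om (cut_field n j).
Proof.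
have [K [cK KO e0]] := csupp_cutoff n; exists K; split => // x /e0 h.
by rewrite cut_fieldE h mul0r.
Qed.

Lemma solenoidal_cut_field n : solenoidal_c Om (cut_field n).
Proof.
have Ch m : Ck_on Om m (fun x => cutoff n x * Psi1 k th (sq x)).
  exact: Ck_onM oOm (Ck_on_cutoff n m oOm) (Ck_on_Psi1 A0 k th m).
split=> [i|x].
  split; last exact: csupp_cut_field.
  move=> m; apply: (csupp_Ck _ (csupp_cut_field n i)).
  exact: Ck_on_rot oOm (Ch m).
have [Ox|Ox] := pselect (Om x); last first.
  apply: big1 => i _.
  have [K [_ KO h]] := csupp_partial i (csupp_cut_field n i).
  by apply: h => /KO.
have x0 := annulus_Xpos A0 Ox.
apply: (div_rot_field (Ch 1%N) Ox (g := cutoff n x * (Psi2 k th (sq x) * 2) +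
  Psi1 k th (sq x) *
    (flatexp 2 (n%:R * wall A x - 1) * n%:R * wall_grad x))) => i.
rewrite (partialM i (Ck_on_cutoff n 1 oOm) (Ck_on_Psi1 A0 k th 1) Ox).
by rewrite partial_cutoff (partial_radial i (is_derive_Psi1 k th x0)); ring.
Qed.

End Approximants.

End Cutoff.

(** * The eigenfield in the domain of the Stokes operator *)

Section Membership.
Context {R : realType}.
Local Notation X := (R3 R).
Variables (A : R).
Hypothesis A0 : 0 < A.
Local Notation a := (A / 2).
Local Notation b := (1 + A / 2).
Local Notation Om := (annulus A).
Local Notation J f := (Rintegral (leb3 R) Om f).
Variables (k th : R).
Hypothesis qa : Psi1 k th (a ^+ 2) = 0.
Hypothesis qb : Psi1 k th (b ^+ 2) = 0.
Implicit Types (i j : 'I_3) (x : X) (n : nat).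

Local Notation oOm := (open_annulus A0).
Local Notation OmM := (annulus_box A0).
Local Notation u := (eigenfield k th).
Local Notation v := (cut_field A k th).

Lemma cvg_sum3 (F : 'I_3 -> nat -> R) :
  (forall i, F i n @[n --> \oo] --> (0 : R)) ->
  \sum_(i < 3) F i n @[n --> \oo] --> (0 : R).
Proof.
move=> hF; rewrite (_ : (fun n => _) =
    (fun n => F ord0 n + F (lift ord0 ord0) n + F ord_max n)).
  rewrite -[X in _ --> X](addr0 (0 : R)) -[X in X + _](addr0 (0 : R)).
  by apply: cvgD => //; apply: cvgD.
by apply/funext => n; rewrite sum3E.
Qed.

Let t n x : R := n%:R * wall A x - 1.

Let t_gt0 x : Om x -> \forall n \near \oo, 0 < t n x.
Proof.
move=> /(wall_gt0 A0) w0; near=> n.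
have : 2 / wall A x <= n%:R by near: n; exact: nbhs_infty_ger.
by rewrite ler_pdivrMr// /t; lra.
Unshelve. all: by end_near. Qed.

Let cvg_invt x : Om x -> (t n x)^-1 @[n --> \oo] --> (0 : R).
Proof.
move=> Ox; have w0 := wall_gt0 A0 Ox; apply/cvgrPdist_le => e e0; near=> n.
have t0 : 0 < t n x by near: n; exact: t_gt0.
have : (e^-1 + 1) / wall A x <= n%:R by near: n; exact: nbhs_infty_ger.
rewrite ler_pdivrMr// sub0r normrN gtr0_norm ?invr_gt0// => h.
by rewrite -[leRHS]invrK lef_pV2 ?posrE ?invr_gt0// /t; lra.
Unshelve. all: by end_near. Qed.

Lemma cvg_cutoff x : Om x -> cutoff A n x - 1 @[n --> \oo] --> (0 : R).
Proof.
move=> Ox.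
apply: (@squeeze_cvgr _ _ _ _ (fun n => - (t n x)^-1) (cst 0)).
- near=> n; have t0 : 0 < t n x by near: n; exact: t_gt0.
  have := flatexp0_ge t0; have := cutoff_le1 A n x.
  by rewrite /cutoff -/(t n x) => h1 h2; apply/andP; split; rewrite /cst; lra.
- by rewrite -[X in _ --> X]oppr0; apply: cvgN; exact: cvg_invt.
- exact: (@cvg_cst _ (0 : R)).
Unshelve. all: by end_near. Qed.

(** The gradient of the cutoff is large only near the boundary, where it is of
  the order of the inverse of [wall A]; the eigenfield compensates for it. *)
Lemma partial_cutoff_le : exists2 C, 0 <= C & forall n i j x, Om x ->
  `|partial i (cutoff A n) x * u j x| <= C * ((t n x + 1) * flatexp 2 (t n x)).
Proof.
have [K K0 hK] := wall_grad_le A0.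
have [C C0 hC] := eigenfield_le A0 qa qb.
exists (K * C) => [|n i j x Ox]; first exact: mulr_ge0.
rewrite partial_cutoff -/(t n x) normrM [`|flatexp _ _ * _ * _|]normrM.
rewrite [`|flatexp _ _ * _|]ger0_norm ?mulr_ge0 ?flatexp_ge0//.
have -> : K * C * ((t n x + 1) * flatexp 2 (t n x)) =
    flatexp 2 (t n x) * n%:R * K * (C * wall A x).
  by rewrite {1}/t; ring.
have f0 : 0 <= flatexp 2 (t n x) * n%:R by rewrite mulr_ge0 ?flatexp_ge0.
apply: ler_pM; [exact: mulr_ge0|by []| |exact: hC].
by apply: ler_wpM2l => //; exact: hK.
Qed.

Let D j n := J (fun x => ((cutoff A n x - 1) * u j x) ^+ 2).

Let G i j n := J (fun x => (partial i (cutoff A n) x * u j x) ^+ 2).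

Let bu j : bcont Om (u j) := bcont_eigenfield A0 qa qb j.

Let b_sqr f : bcont Om f -> bcont Om (fun x => f x ^+ 2).
Proof.
move=> bf; have := bcontM bf bf.
by under [in X in _ -> X]eq_fun do rewrite expr2.
Qed.

Let b_cutoff n : bcont Om (cutoff A n).
Proof. exact: Ck_bcont (Ck_on_cutoff A n 0 oOm) (csupp_cutoff A0 n). Qed.

Let b_partial n i : bcont Om (partial i (cutoff A n)).
Proof.
exact: Ck_bcont (Ck_on_partial i (Ck_on_cutoff A n 1 oOm))
  (csupp_partial i (csupp_cutoff A0 n)).
Qed.

Let bD j n : bcont Om (fun x => (cutoff A n x - 1) * u j x).
Proof. exact: bcontM (bcontB (b_cutoff n) (bcont_cst Om 1)) (bu j). Qed.

Let bG i j n : bcont Om (fun x => partial i (cutoff A n) x * u j x).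
Proof. exact: bcontM (b_partial n i) (bu j). Qed.

Let cvg_D j : D j n @[n --> \oo] --> (0 : R).
Proof.
have [_ [B hB]] := bu j.
apply: (bounded_convergence0 oOm OmM (B := B ^+ 2)).
- by move=> n; exact: b_sqr (bD j n).
- move=> n x Ox; rewrite ger0_norm ?sqr_ge0// exprMn -[leRHS]mul1r.
  apply: ler_pM; rewrite ?sqr_ge0//.
    have := cutoff_ge0 A n x; have := cutoff_le1 A n x.
    by move: (cutoff A n x) => e; nra.
  rewrite -(real_normK (num_real (u j x))) ler_sqr ?nnegrE//; first exact: hB.
  exact: le_trans (hB x Ox).
- move=> x Ox; have e1 := cvg_cutoff Ox.
  have -> : (fun n => ((cutoff A n x - 1) * u j x) ^+ 2) =
      (fun n => (cutoff A n x - 1) * ((cutoff A n x - 1) * u j x ^+ 2)).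
    by apply/funext => n; ring.
  rewrite -[X in _ --> X](mul0r (0 * u j x ^+ 2)).
  by apply: cvgM => //; apply: cvgMr_tmp.
Qed.

Let cvg_G i j : G i j n @[n --> \oo] --> (0 : R).
Proof.
have [C C0 hC] := partial_cutoff_le.
apply: (bounded_convergence0 oOm OmM (B := (C * 3) ^+ 2)).
- by move=> n; exact: b_sqr (bG i j n).
- move=> n x Ox; rewrite ger0_norm ?sqr_ge0//.
  rewrite -(real_normK (num_real (_ * u j x))) ler_sqr ?nnegrE ?mulr_ge0//.
  apply: le_trans (hC n i j x Ox) _; apply: ler_wpM2l => //.
  exact: flatexp2_le3.
- move=> x Ox; pose s n := (t n x)^-1 + (t n x)^-1 * (t n x)^-1.
  have s0 : s n @[n --> \oo] --> (0 : R).
    rewrite -[X in _ --> X](addr0 (0 : R)) -[X in _ + X](mulr0 (0 : R)).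
    by apply: cvgD; [exact: cvg_invt|apply: cvgM; exact: cvg_invt].
  apply: (@squeeze_cvgr _ _ _ _ (cst 0) (fun n => C * s n * (C * s n))).
  + near=> n; have t0 : 0 < t n x by near: n; exact: t_gt0.
    have h : `|partial i (cutoff A n) x * u j x| <= C * s n.
      apply: le_trans (hC n i j x Ox) _; apply: ler_wpM2l => //.
      by rewrite /s -expr2; exact: flatexp2_le.
    rewrite sqr_ge0/= -(real_normK (num_real (_ * u j x))) expr2.
    by apply: ler_pM.
  + exact: (@cvg_cst _ (0 : R)).
  + have z : C * s n @[n --> \oo] --> C * 0 by apply: cvgMl_tmp.
    by rewrite mulr0 in z; rewrite -[X in _ --> X](mul0r (0 : R)); apply: cvgM.
Unshelve. all: by end_near. Qed.

Let S n := \sum_(j < 3) (k ^+ 2 * D j n + \sum_(i < 3) G i j n).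

Let cvg_S : S n @[n --> \oo] --> (0 : R).
Proof.
apply: cvg_sum3 => j; rewrite -[X in _ --> X](addr0 (0 : R)).
rewrite -[X in X + _](mulr0 (k ^+ 2)).
apply: cvgD; first by apply: cvgMl_tmp; exact: cvg_D.
by apply: cvg_sum3 => i; exact: cvg_G.
Qed.

Lemma dist_cut_field n : ip_dist2 (L2_ip Om) (v n) u = \sum_(j < 3) D j n.
Proof.
rewrite /ip_dist2 /L2_ip -(integral_on_sum oOm OmM (fun j => b_sqr (bD j n))).
apply: eq_integral_on => x _; apply: eq_bigr => j _.
have -> : (v n - u) j x = (cutoff A n x - 1) * u j x.
  by rewrite mulrBl mul1r -cut_fieldE.
by rewrite expr2.
Qed.

Let csuppB m n : csupp Om (fun x => cutoff A m x - cutoff A n x).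
Proof. exact: csuppD (csupp_cutoff A0 m) (csuppN (csupp_cutoff A0 n)). Qed.

Let Ck_cutoffB d m n : Ck_on Om d (fun x => cutoff A m x - cutoff A n x).
Proof. exact: Ck_onB oOm (Ck_on_cutoff A m d oOm) (Ck_on_cutoff A n d oOm). Qed.

(** By the ground state identity the energy of a difference of two approximants
  does not involve the derivatives of the eigenfield. *)
Lemma energy_cut_field m n :
  L2_ip Om (- laplacian3 (v m - v n)) (v m - v n) <= 2 * (S m + S n).
Proof.
pose z x := cutoff A m x - cutoff A n x.
have vz j : (v m - v n) j = (fun x => z x * u j x).
  apply/funext => x; rewrite /z mulrBl -!cut_fieldE; exact: erefl.
have bz : bcont Om z by exact: bcontB (b_cutoff m) (b_cutoff n).
have Cz d : Ck_on Om d z := Ck_cutoffB d m n.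
have Cu d j := Ck_on_eigenfield A0 k th d j.
have bzu j : bcont Om (fun x => z x * u j x) := bcontM bz (bu j).
have bl j : bcont Om (lap (fun x => z x * u j x)).
  have C2 := Ck_onM oOm (Cz 2%N) (Cu 2%N j).
  exact: Ck_bcont (Ck_on_lap oOm C2) (csupp_lap (csuppM (u j) (csuppB m n))).
have pz i x : Om x ->
    partial i z x = partial i (cutoff A m) x - partial i (cutoff A n) x.
  exact: partialB oOm (Ck_on_cutoff A m 1 oOm) (Ck_on_cutoff A n 1 oOm).
have bpz i j : bcont Om (fun x => (partial i z x * u j x) ^+ 2).
  have bp := Ck_bcont (Ck_on_partial i (Cz 1%N)) (csupp_partial i (csuppB m n)).
  exact: b_sqr (bcontM bp (bu j)).
have le2 (p q r : R) : (p - q) ^+ 2 <= 2 * ((p - r) ^+ 2 + (q - r) ^+ 2).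
  by have := sqr_ge0 ((p - r) + (q - r)); nra.
have J_le f g h : bcont Om f -> bcont Om g -> bcont Om h ->
    (forall x, Om x -> f x ^+ 2 <= 2 * (g x ^+ 2 + h x ^+ 2)) ->
    J (fun x => f x ^+ 2) <=
    2 * (J (fun x => g x ^+ 2) + J (fun x => h x ^+ 2)).
  move=> bf bg bh fgh.
  have bgh := bcontD (b_sqr bg) (b_sqr bh).
  rewrite -(integral_onD oOm OmM (b_sqr bg) (b_sqr bh)).
  rewrite -(integral_onZ oOm OmM 2 bgh).
  apply: le_Rintegral => //; first exact: (measurable_Om oOm).
  - exact: (bcont_integrable oOm OmM (b_sqr bf)).
  - exact: (bcont_integrable oOm OmM (bcontZ 2 bgh)).
rewrite /L2_ip (eq_integral_on (g := fun x => \sum_(j < 3)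
    - lap (fun x => z x * u j x) x * (z x * u j x))); last first.
  move=> x _; apply: eq_bigr => j _; rewrite laplacian3E.
  by rewrite (vz j).
rewrite (integral_on_sum oOm OmM (fun j => bcontM (bcontN (bl j)) (bzu j))).
rewrite /S -big_split/= mulr_sumr; apply: ler_sum => j _.
rewrite (ground_state oOm OmM (Cu 2%N j) (Cz 2%N) (csuppB m n)
  (lap_eigenfield A0 k th j)).
rewrite (integral_on_sum oOm OmM (bpz ^~ j)).
have hD : J (fun x => (z x * u j x) ^+ 2) <= 2 * (D j m + D j n).
  apply: (J_le _ _ _ (bzu j) (bD j m) (bD j n)) => x _.
  rewrite /=; move: (u j x) => c; rewrite !exprMn -mulrDl [leRHS]mulrA.
  by rewrite ler_wpM2r ?sqr_ge0//; exact: (le2 (cutoff A m x) (cutoff A n x) 1).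
have hG i :
    J (fun x => (partial i z x * u j x) ^+ 2) <= 2 * (G i j m + G i j n).
  apply: J_le (bG i j m) (bG i j n) _.
    exact: bcontM (Ck_bcont (Ck_on_partial i (Cz 1%N))
      (csupp_partial i (csuppB m n))) (bu j).
  move=> x Ox; rewrite /= (pz i x Ox); move: (u j x) => c.
  rewrite !exprMn -mulrDl [leRHS]mulrA ler_wpM2r ?sqr_ge0//.
  move: (partial i (cutoff A m) x) (partial i (cutoff A n) x) => p q.
  by have := le2 p q 0; rewrite !subr0.
have hGs : \sum_(i < 3) J (fun x => (partial i z x * u j x) ^+ 2) <=
    2 * (\sum_(i < 3) G i j m + \sum_(i < 3) G i j n).
  by rewrite -big_split/= mulr_sumr; apply: ler_sum => i _; exact: hG.
apply: le_trans (lerD (ler_wpM2l (sqr_ge0 k) hD) hGs) _.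
have E (c p q r s : R) :
  c * (2 * (p + q)) + 2 * (r + s) = 2 * (c * p + r + (c * q + s)) by ring.
by rewrite E.
Qed.

Lemma cut_field_cvg : ip_dist2 (L2_ip Om) (v n) u @[n --> \oo] --> (0 : R).
Proof.
under eq_fun do rewrite dist_cut_field.
by apply: cvg_sum3 => j; exact: cvg_D.
Qed.

Lemma cut_field_Cauchy e : 0 < e -> exists N, forall m n,
  (N <= m)%N -> (N <= n)%N ->
  L2_ip Om (- laplacian3 (v m - v n)) (v m - v n) < e.
Proof.
move=> e0; have e4 : 0 < e / 4 by lra.
have /cvgrPdist_lt/(_ _ e4)[N _ hN] := cvg_S.
exists N => m n Nm Nn; apply: le_lt_trans (energy_cut_field m n) _.
have small p : (N <= p)%N -> S p < e / 4.
  move=> Np; apply: le_lt_trans (ler_norm _) _; rewrite -normrN -sub0r.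
  exact: hN.
by move: (S m) (S n) (small m Nm) (small n Nn) => p q; lra.
Qed.

Lemma eigenfield_L2_sigma : L2_sigma Om u.
Proof.
split; first by apply: (bcont_L2 oOm OmM); exact: bu.
move=> e e0; have /cvgrPdist_lt/(_ _ e0)[N _ hN] := cut_field_cvg.
exists (v N); first exact: (solenoidal_cut_field A0).
apply: le_lt_trans (ler_norm _) _; rewrite -normrN -sub0r.
exact: hN (leqnn N).
Qed.

(** The eigenfield does not vanish outside a compact part of the shell, but the
  test field does, which is what Green's identity requires. *)
Lemma stokes_eigenfield : stokes Om u (k ^+ 2 *: u).
Proof.
split.
- split; first exact: eigenfield_L2_sigma.
  exists v; split; [exact: (solenoidal_cut_field A0)|exact: cut_field_cvg|].
  exact: cut_field_Cauchy.
- exact: (L2_sigmaZ oOm OmM _ eigenfield_L2_sigma).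
- have lE j x : Om x -> (- laplacian3 u) j x = k ^+ 2 * u j x.
    move=> Ox; rewrite laplacian3E (lap_eigenfield A0 k th j Ox); ring.
  move=> w hw; rewrite (stokes_Green oOm OmM _ _ bu hw).
  + apply: eq_integral_on => x Ox; apply: eq_bigr => j _.
    by rewrite (lE j x Ox).
  + by move=> j; exact: Ck_on_eigenfield.
  + move=> j; have [c [B hB]] := bcontZ (- k ^+ 2) (bu j); split.
      have C := Ck_on_lap oOm (Ck_on_eigenfield A0 k th 2 j).
      by move=> x; exact: Ck_on_continuous C.
    by exists B => x Ox; rewrite (lap_eigenfield A0 k th j Ox); exact: hB.
Qed.

Lemma stokes_eigenvalue_sqr x0 j : Om x0 -> u j x0 != 0 ->
  eigenvalues (L2_ip Om) (stokes Om) (k ^+ 2).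
Proof.
move=> Ox0 u0; exists u; last exact: stokes_eigenfield.
rewrite gt_eqF//; apply: (integral_on_gt0 oOm OmM (x0 := x0)) => //.
- by apply: bcont_sum => i; exact: bcontM.
- by move=> x _; apply: sumr_ge0 => i _; rewrite -expr2 sqr_ge0.
- apply: lt0r_neq0; rewrite (bigD1 j)//= ltr_pwDl//.
    by rewrite -expr2 exprn_even_gt0.
  by apply: sumr_ge0 => i _; rewrite -expr2 sqr_ge0.
Qed.

End Membership.

(** * The wave number and the limit *)

Section Limit.
Context {R : realType}.
Implicit Types (k A : R).

(** The phase equation of the toroidal mode of degree one: the two boundary
  conditions say that the tangent of the phase is [k r] at both radii, and the
  phase increases by [k] across the shell, which has width one. Adding [pi] to
  the difference of the arctangents selects the first mode. *)
Lemma wave_number_exists A : 0 < A -> exists2 k, pi <= k <= pi + pi / 2 &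
  k = pi + atan (k * (1 + A / 2)) - atan (k * (A / 2)).
Proof.
move=> A0; have p0 := @pi_gt0 R.
pose f k : R := k + atan (k * (A / 2)) - atan (k * (1 + A / 2)).
have cf : continuous f.
  have c c0 : continuous (fun k : R => atan (k * c0)).
    move=> k; apply: (@continuous_comp _ _ _ (fun k : R => k * c0) atan).
      exact: mulrr_continuous.
    exact: continuous_atan.
  move=> k; apply: cvgB; last exact: c.
  by apply: cvgD; [exact: cvg_id|exact: c].
have le0 : 0 <= pi + pi / 2 - pi :> R by lra.
have f1 : f pi <= pi.
  rewrite /f; have : atan (pi * (A / 2)) <= atan (pi * (1 + A / 2)) :> R.
    by apply: le_atan; rewrite ler_wpM2l ?ltW//; lra.
  by lra.
have f2 : pi <= f (pi + pi / 2).
  rewrite /f; have := atan_ltpi2 ((pi + pi / 2) * (1 + A / 2)).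
  have : atan 0 <= atan ((pi + pi / 2) * (A / 2)).
    by apply: le_atan; rewrite mulr_ge0//; lra.
  by rewrite atan0; lra.
have [|||k] := @IVT R f pi (pi + pi / 2) pi.
- by lra.
- exact: continuous_subspaceT.
- by rewrite ge_min f1 le_max f2 orbT.
rewrite in_itv/= => kk fk; exists k => //.
by move: fk; rewrite /f; lra.
Qed.

Lemma sin_atanM (t : R) : sin (atan t) = t * cos (atan t).
Proof.
have c0 : cos (atan t) != 0.
  by rewrite gt_eqF// cos_gt0_pihalf// atan_gtNpi2 atan_ltpi2.
have e : t = sin (atan t) / cos (atan t) by rewrite -[LHS]atanK.
by rewrite [X in X * _]e divfK.
Qed.

Lemma eigenvalue_wave_number A k : 0 < A -> 0 < k ->
  k = pi + atan (k * (1 + A / 2)) - atan (k * (A / 2)) ->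
  eigenvalues (L2_ip (annulus A)) (stokes (annulus A)) (k ^+ 2).
Proof.
move=> A0 k0 kE; pose a := A / 2; pose b := 1 + A / 2.
pose th := atan (k * a) - k * a.
have a0 : 0 < a by rewrite /a; lra.
have b0 : 0 < b by rewrite /b; lra.
have ab : b = 1 + a by [].
have qa : Psi1 k th (a ^+ 2) = 0.
  rewrite /Psi1 sqrtr_sqr gtr0_norm// (_ : k * a + th = atan (k * a)).
    by rewrite sin_atanM subrr mul0r.
  by rewrite /th; ring.
have qb : Psi1 k th (b ^+ 2) = 0.
  rewrite /Psi1 sqrtr_sqr gtr0_norm// (_ : k * b + th = atan (k * b) + pi).
    by rewrite sinDpi cosDpi sin_atanM mulrN opprK addNr mul0r.
  have -> : k * b + th = k + atan (k * a) by rewrite /th ab; ring.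
  by rewrite {1}kE -/a -/b; ring.
(* The phase reaches [pi] inside the shell, where the profile cannot vanish. *)
pose r := a + (pi - atan (k * a)) / k.
have ra : a < r.
  rewrite /r ltrDl divr_gt0// subr_gt0.
  by have := atan_ltpi2 (k * a); have := @pi_gt0 R; lra.
have rb : r < b.
  rewrite /r ab addrC ltrD2r ltr_pdivrMr// mul1r.
  have : atan 0 < atan (k * b) by apply: lt_atan; rewrite mulr_gt0.
  by rewrite atan0 => h; rewrite [ltRHS]kE -/a -/b; lra.
have r0 : 0 < r by lra.
pose x0 : R3 R := (r, 0, 0).
have sx : sq x0 = r ^+ 2.
  by rewrite /sq !big_ord_recr/= big_ord0 /crd/= expr0n/= !addr0 add0r.
have Ox : annulus A x0.
  by rewrite /annulus/= /enorm3 -/(sq x0) sx sqrtr_sqr gtr0_norm// ra rb.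
have Psir : Psi1 k th (sq x0) != 0.
  rewrite sx /Psi1 sqrtr_sqr gtr0_norm//.
  have -> : k * r + th = pi by rewrite /r /th; field; rewrite gt_eqF.
  rewrite cospi sinpi subr0 mulrN1 mulNr oppr_eq0 gt_eqF//.
  by rewrite divr_gt0 ?mulr_gt0 ?exprn_gt0.
apply: (stokes_eigenvalue_sqr A0 qa qb (j := lift ord0 ord0) Ox).
have -> : eigenfield k th (lift ord0 ord0) x0 = - (Psi1 k th (sq x0) * r).
  by rewrite /eigenfield /rot_field mulN1r.
by rewrite oppr_eq0 mulf_eq0 negb_or Psir gt_eqF.
Qed.

Lemma stokes_eigenvalue1_bounds A : 0 < A -> pi ^+ 2 <= stokes_eigenvalue1 A <=
  (pi + pi / 2 - atan (pi * (A / 2))) ^+ 2.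
Proof.
move=> A0; have p0 := @pi_gt0 R.
have [k /andP[k1 k2] kE] := wave_number_exists A0.
have k0 : 0 < k by lra.
have Ek := eigenvalue_wave_number A0 k0 kE.
have lb :
    lbound (eigenvalues (L2_ip (annulus A)) (stokes (annulus A))) (pi ^+ 2).
  by move=> l; exact: annulus_eigenvalue_ge.
apply/andP; split; first by apply: lb_le_inf => //; exists (k ^+ 2).
apply: (@le_trans _ _ (k ^+ 2)); first by apply: ge_inf => //; exists (pi ^+ 2).
have kle : k <= pi + pi / 2 - atan (pi * (A / 2)).
  have := atan_ltpi2 (k * (1 + A / 2)).
  have : atan (pi * (A / 2)) <= atan (k * (A / 2)).
    by apply: le_atan; rewrite ler_wpM2r//; lra.
  by move: kE; lra.
by rewrite ler_sqr ?nnegrE//; lra.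
Qed.

End Limit.

Theorem corollary7 (R : realType) :
  stokes_eigenvalue1 A @[A --> (+oo : set_system R)] --> (pi ^+ 2 : R).
Proof.
have cA : pi * (A / 2) @[A --> (+oo : set_system R)] --> (+oo : set_system R).
  apply: gt0_cvgMry; first exact: pi_gt0.
  by apply: gt0_cvgMly; [rewrite invr_gt0|exact: cvg_id].
have cat : atan (pi * (A / 2)) @[A --> (+oo : set_system R)] --> (pi / 2 : R).
  exact: cvg_comp cA (@cvgy_atan R).
have ck : pi + pi / 2 - atan (pi * (A / 2)) @[A --> (+oo : set_system R)]
    --> (pi : R).
  rewrite -[X in _ --> X](addrK (pi / 2 : R)).
  by apply: cvgB => //; exact: cvg_cst.
apply: (@squeeze_cvgr _ _ _ _ (cst (pi ^+ 2))
  (fun A => (pi + pi / 2 - atan (pi * (A / 2))) ^+ 2)).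
- near=> A; apply: stokes_eigenvalue1_bounds.
  by near: A; apply: nbhs_pinfty_gt; exact: num_real.
- exact: cvg_cst.
- by rewrite expr2; under eq_fun do rewrite expr2; exact: cvgM.
Unshelve. all: by end_near. Qed.
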